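(* Let $K$ be a $D_5$-extension with a unique real embedding $\iota$, let $L$ be its Galois closure, identify $\mathrm{Gal}(L/\mathbf{Q})$ with $D_5$, and let $\sigma\in D_5$ be a $5$-cycle (an element of order $5$). Let $N(x_0,x_1)=x_0^2-x_0x_1-x_1^2$. Then: (1) there exists a unit $u_0\in E_K$ such that, writing $E_K$ additively and setting $u_1=\sigma(u_0)+\sigma^{-1}(u_0)$, the set $\{u_0,u_1\}$ forms a $\mathbf{Z}$-basis of $E_K$; (2) for any such unit $u_0$, the regulator of $K$ is equal to $$\bigl|N(\log|\iota(u_0)|,\ \log|\iota(u_1)|)\bigr|.$$
   Context: A $D_5$-extension is a number field $K$ of degree $5$ over $\mathbf{Q}$ whose Galois closure $L$ over $\mathbf{Q}$ has Galois group isomorphic to the dihedral group $D_5$ of order $10$. $E_K=\mathcal{O}_K^\times/\text{torsion}$ and $E_L=\mathcal{O}_L^\times/\text{torsion}$, viewed as abelian groups written additively; $E_K$ is regarded as a subgroup of $E_L$, on which $\mathrm{Gal}(L/\mathbf{Q})$ acts. In multiplicative notation, $u_1$ is the class of $\sigma(u_0)\,\sigma^{-1}(u_0)$, which lies in $E_K$. The form $N(x_0,x_1)=x_0^2-x_0x_1-x_1^2$ is the norm form of the maximal order $\mathbf{Z}[\zeta_5+\zeta_5^{-1}]$ of $\mathbf{Q}(\zeta_5+\zeta_5^{-1})$ with respect to the basis $\{1,\zeta_5+\zeta_5^{-1}\}$, i.e. $N(x_0,x_1)$ is the norm of $x_0+x_1(\zeta_5+\zeta_5^{-1})$. The regulator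 of $K$ is the usual one: the absolute value of any $2\times 2$ minor of the $2\times3$ matrix whose rows are the images of a $\mathbf{Z}$-basis of $E_K$ under $u\mapsto(\log|\iota(u)|,2\log|\tau_1(u)|,2\log|\tau_2(u)|)$, where $\tau_1,\tau_2$ represent the two pairs of complex conjugate embeddings of $K$. *)

(* Defs.v *)
From HB Require Import structures.
From mathcomp Require Import all_boot all_order all_algebra all_fingroup.
From mathcomp Require Import all_solvable all_field.
From mathcomp Require Import generic_quotient ring_quotient complex.
From mathcomp Require Import boolp reals exp.

Set Implicit Arguments.
Unset Strict Implicit.
Unset Printing Implicit Defensive.

Import GRing.Theory Num.Theory.

Local Open Scope ring_scope.
Local Open Scope quotient_scope.

Section UnitGroup.
Variable F : fieldExtType rat.

Definition algint (x : F) : Prop := integralOver (intr : int -> F) x.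

Definition Ounit : pred F :=
  fun x => `[< algint x /\ exists2 y, algint y & x * y = 1 >].

(* The multiplicative group O_F^*, written additively. *)
Record Ounits := MkOunits { Ounits_val : F; _ : Ounit Ounits_val }.

HB.instance Definition _ := [isSub for Ounits_val].
HB.instance Definition _ := [Choice of Ounits by <:].

Lemma algintM (x y : F) : algint x -> algint y -> algint (x * y).
Proof. exact: integral_mul. Qed.

Lemma Ounit1 : Ounit 1.
Proof.
have i1 : algint 1 by exact: integral1.
by apply/asboolP; split => //; exists 1; rewrite ?mulr1.
Qed.

Lemma OunitM x y : Ounit x -> Ounit y -> Ounit (x * y).
Proof.
move=> /asboolP[ix [x' ix' xx']] /asboolP[iy [y' iy' yy']].
apply/asboolP; split; first exact: algintM.
by exists (x' * y'); [exact: algintM|rewrite mulrACA xx' yy' mulr1].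
Qed.

Lemma OunitV x : Ounit x -> Ounit x^-1.
Proof.
move=> /asboolP[ix [y iy xy]].
have -> : x^-1 = y.
  have x0 : x != 0.
    by apply/eqP => x0; move: xy; rewrite x0 mul0r => /esym/eqP; rewrite oner_eq0.
  by rewrite -[y](mulKf x0) xy mulr1.
by apply/asboolP; split => //; exists x; rewrite // mulrC.
Qed.

Lemma Ounit_neq0 x : Ounit x -> x != 0.
Proof.
move=> /asboolP[_ [y _ xy]]; apply/eqP => x0; move: xy.
by rewrite x0 mul0r => /esym/eqP; rewrite oner_eq0.
Qed.

Definition Ounits_zero : Ounits := MkOunits Ounit1.
Definition Ounits_opp (u : Ounits) : Ounits := MkOunits (OunitV (valP u)).
Definition Ounits_add (u v : Ounits) : Ounits :=
  MkOunits (OunitM (valP u) (valP v)).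

Fact Ounits_addA : associative Ounits_add.
Proof. by move=> u v w; apply/val_inj; rewrite /= mulrA. Qed.
Fact Ounits_addC : commutative Ounits_add.
Proof. by move=> u v; apply/val_inj; rewrite /= mulrC. Qed.
Fact Ounits_add0 : left_id Ounits_zero Ounits_add.
Proof. by move=> u; apply/val_inj; rewrite /= mul1r. Qed.
Fact Ounits_addN : left_inverse Ounits_zero Ounits_opp Ounits_add.
Proof. by move=> u; apply/val_inj; rewrite /= mulVf // Ounit_neq0 // (valP u). Qed.

HB.instance Definition _ :=
  GRing.isZmodule.Build Ounits Ounits_addA Ounits_addC Ounits_add0 Ounits_addN.

Definition torsion : pred Ounits :=
  fun u => `[< exists2 n : nat, (0 < n)%N & u *+ n = 0 >].

Fact torsion_zmod_closed : zmod_closed torsion.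
Proof.
split; first by apply/asboolP; exists 1%N.
move=> u v /asboolP[m m0 um] /asboolP[n n0 vn]; apply/asboolP.
exists (m * n)%N; first by rewrite muln_gt0 m0.
by rewrite mulrnBl mulrnA um mul0rn mulnC mulrnA vn mul0rn subr0.
Qed.

HB.instance Definition _ :=
  GRing.isZmodClosed.Build Ounits torsion torsion_zmod_closed.

(* E_F = O_F^* / torsion, written additively. *)
Definition Egroup := Quotient.quot (GRing.ZmodClosed.clone Ounits torsion _).

HB.instance Definition _ := GRing.Zmodule.on Egroup.
HB.instance Definition _ := ZmodQuotient.on Egroup.

Lemma eq_piE (u v : Ounits) :
  reflect (exists2 n : nat, (0 < n)%N & (u - v) *+ n = 0)
          (u == v %[mod Egroup]).
Proof. by rewrite -Quotient.idealrBE; apply: asboolP. Qed.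

Lemma Ounits_valX (u : Ounits) n : \val (u *+ n) = \val u ^+ n.
Proof. by elim: n => [//|n IHn]; rewrite mulrS exprS -IHn. Qed.

End UnitGroup.

Section Functoriality.
Variables (F F' : fieldExtType rat) (f : {rmorphism F -> F'}).

Lemma algint_rmorph x : algint x -> algint (f x).
Proof.
move=> [p mon_p px]; exists p => //.
rewrite -(eq_map_poly (fun n => rmorph_int f n)) map_poly_comp /=.
exact: rmorph_root.
Qed.

Lemma Ounit_rmorph x : Ounit x -> Ounit (f x).
Proof.
move=> /asboolP[ix [y iy xy]]; apply/asboolP; split; first exact: algint_rmorph.
by exists (f y); [exact: algint_rmorph|rewrite -rmorphM xy rmorph1].
Qed.

Definition Ounits_map (u : Ounits F) : Ounits F' :=
  MkOunits (Ounit_rmorph (valP u)).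

Fact Ounits_map_zmod : zmod_morphism Ounits_map.
Proof. by move=> u v; apply/val_inj; rewrite /= rmorphM fmorphV. Qed.

HB.instance Definition _ :=
  GRing.isZmodMorphism.Build (Ounits F) (Ounits F') Ounits_map Ounits_map_zmod.

(* Defined through representatives; see E_map_pi. *)
Definition E_map (u : Egroup F) : Egroup F' :=
  \pi_(Egroup F') (Ounits_map (repr u)).

Lemma E_map_pi (u : Ounits F) :
  E_map (\pi_(Egroup F) u) = \pi_(Egroup F') (Ounits_map u).
Proof.
apply/eqP/eq_piE.
have /eqP/eq_piE[n n0 hn] : repr (\pi_(Egroup F) u) = u %[mod Egroup F].
  by rewrite reprK.
by exists n => //; rewrite -raddfB -raddfMn hn raddf0.
Qed.

Fact E_map_zmod : zmod_morphism E_map.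
Proof.
move=> u v; rewrite -[u]reprK -[v]reprK -raddfB !E_map_pi.
by rewrite raddfB /= raddfB.
Qed.

HB.instance Definition _ :=
  GRing.isZmodMorphism.Build (Egroup F) (Egroup F') E_map E_map_zmod.

End Functoriality.

Lemma norm_repr_pi (F : fieldExtType rat) (A : numFieldType)
    (f : {rmorphism F -> A}) (u : Ounits F) :
  `|f (\val (repr (\pi_(Egroup F) u)))| = `|f (\val u)|.
Proof.
have /eqP/eq_piE[n n0 hn] : repr (\pi_(Egroup F) u) = u %[mod Egroup F].
  by rewrite reprK.
set v := repr _ in hn *.
have hv : \val v = \val (v - u) * \val u by rewrite -[in LHS](subrK u v).
have /(congr1 (fun x => `|f x|)) : \val (v - u) ^+ n = 1.
  by rewrite -Ounits_valX hn.
rewrite rmorphXn normrX rmorph1 normr1 => /eqP.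
rewrite pexpr_eq1 ?normr_ge0 // => /eqP h1.
by rewrite hv rmorphM normrM h1 mul1r.
Qed.

(* log |iota u| for a real embedding iota, resp. log |tau u| for a complex one,
   of a class u modulo torsion, computed on a representative; the lemmas
   log_real_pi and log_complex_pi give independence of the representative. *)
Section LogAbs.
Variables (R : realType) (F : fieldExtType rat).

Definition log_real (iota : {rmorphism F -> R}) (u : Egroup F) : R :=
  ln `|iota (\val (repr u))|.

Definition log_complex (tau : {rmorphism F -> R[i]}) (u : Egroup F) : R :=
  ln (Normc.normc (tau (\val (repr u)))).

Lemma log_real_pi iota (u : Ounits F) :
  log_real iota (\pi_(Egroup F) u) = ln `|iota (\val u)|.
Proof. by rewrite /log_real norm_repr_pi. Qed.

Lemma log_complex_pi tau (u : Ounits F) :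
  log_complex tau (\pi_(Egroup F) u) = ln (Normc.normc (tau (\val u))).
Proof. by have [e] := norm_repr_pi tau u; rewrite /log_complex e. Qed.

End LogAbs.

Definition is_Zbasis (A : zmodType) (n : nat) (b : n.-tuple A) : Prop :=
  forall a : A, exists! c : 'rV[int]_n, a = \sum_(i < n) tnth b i *~ c 0 i.

Section Regulator.
Variables (R : realType) (F : fieldExtType rat).

Definition nonreal_embedding (tau : {rmorphism F -> R[i]}) : Prop :=
  exists x, complex.Im (tau x) != 0.

Definition conj_embeddings (tau rho : {rmorphism F -> R[i]}) : Prop :=
  forall x, rho x = conjc (tau x).

(* The non-real embeddings of F form exactly the two conjugate pairs
   {tau1, conj tau1} and {tau2, conj tau2}. *)
Definition represent_complex_pairs (tau1 tau2 : {rmorphism F -> R[i]}) : Prop :=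
  [/\ nonreal_embedding tau1, nonreal_embedding tau2,
      ~ tau1 =1 tau2, ~ conj_embeddings tau1 tau2
    & forall rho, nonreal_embedding rho ->
      [\/ rho =1 tau1, conj_embeddings tau1 rho,
          rho =1 tau2 | conj_embeddings tau2 rho]].

Definition log_embedding (iota : {rmorphism F -> R})
    (tau1 tau2 : {rmorphism F -> R[i]}) (u : Egroup F) : 'rV[R]_3 :=
  \row_j tnth [tuple log_real iota u; 2 * log_complex tau1 u;
                     2 * log_complex tau2 u] j.

Definition regulator_matrix (iota : {rmorphism F -> R})
    (tau1 tau2 : {rmorphism F -> R[i]}) (b : 2.-tuple (Egroup F)) :
    'M[R]_(2, 3) :=
  \matrix_(i < 2) log_embedding iota tau1 tau2 (tnth b i).

(* k is the index of the deleted column. *)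
Definition abs_minor (iota : {rmorphism F -> R})
    (tau1 tau2 : {rmorphism F -> R[i]}) (b : 2.-tuple (Egroup F))
    (k : 'I_3) : R :=
  `|\det (col' k (regulator_matrix iota tau1 tau2 b) : 'M[R]_2)|.

(* The regulator of a number field F with one real embedding iota and two
   pairs of complex embeddings is the common value r of all these minors; the
   first clause prevents the second one from being vacuous. *)
Definition is_regulator (iota : {rmorphism F -> R}) (r : R) : Prop :=
  (exists (b : 2.-tuple (Egroup F)) tau1 tau2,
     is_Zbasis b /\ represent_complex_pairs tau1 tau2) /\
  (forall (b : 2.-tuple (Egroup F)) tau1 tau2 k,
     is_Zbasis b -> represent_complex_pairs tau1 tau2 ->
     abs_minor iota tau1 tau2 b k = r).

End Regulator.

Definition unique_real_embedding (R : realType) (F : fieldExtType rat)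
    (iota : {rmorphism F -> R}) : Prop :=
  forall iota' : {rmorphism F -> R}, iota' =1 iota.

Section D5.
Variable L : splittingFieldType rat.

Definition is_Galois_closure (K : {subfield L}) : Prop :=
  galois 1 {:L} /\
  forall M : {subfield L}, (K <= M)%VS -> galois 1 M -> M = {:L}%VS :> {vspace L}.

Definition D5_extension (K : {subfield L}) : Prop :=
  [/\ \dim K = 5%N, is_Galois_closure K & 'Gal({:L} / 1) \isog 'D_10].

(* The embedding E_K -> E_L. *)
Definition E_incl (K : {subfield L}) : Egroup (subvs_of K) -> Egroup L :=
  E_map (vsval : {rmorphism subvs_of K -> L}).

Lemma E_incl_inj (K : {subfield L}) : injective (@E_incl K).
Proof.
move=> u v; rewrite -[u]reprK -[v]reprK /E_incl !E_map_pi => /eqP/eq_piE[n n0 h].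
apply/eqP/eq_piE; exists n => //; apply: val_inj.
move: h; rewrite -raddfB -raddfMn => /(congr1 val) /= h.
apply: (fmorph_inj (vsval : {rmorphism subvs_of K -> L})).
by apply: etrans h _; rewrite -(rmorph1 (vsval : {rmorphism subvs_of K -> L})).
Qed.

Definition E_gal (s : gal_of {:L}) : Egroup L -> Egroup L :=
  E_map (s : {rmorphism L -> L}).

(* u1 in E_K is determined by this, by E_incl_inj. *)
Definition is_gal_trace (K : {subfield L}) (s : gal_of {:L})
    (u0 u1 : Egroup (subvs_of K)) : Prop :=
  E_incl u1 = E_gal s (E_incl u0) + E_gal s^-1%g (E_incl u0).

End D5.

(* The norm of x0 + x1 (zeta_5 + zeta_5^-1). *)
Definition N5 (R : pzRingType) (x0 x1 : R) : R := x0 ^+ 2 - x0 * x1 - x1 ^+ 2.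

(* Main.v *)
Require Import Defs.
From HB Require Import structures.
From mathcomp Require Import all_boot all_order all_algebra all_fingroup.
From mathcomp Require Import all_solvable all_field.
From mathcomp Require Import generic_quotient ring_quotient complex.
From mathcomp Require Import boolp reals sequences exp.
From mathcomp Require Import ring lra zify.

(** Extend iota to an embedding J of L into the complex numbers. Complex
conjugation restricts to a reflection c of Gal(L/Q) with K = L^c and
c sigma c = sigma^-1, and the embeddings of K are the J sigma^k with k = 0..4,
of which k and -k are conjugate (conj_embedding_exists). Hence the absolute
values of u in E_K are governed by l_k(u) = ln |J sigma^k u| for k = 0, 1, 2,
and as units have norm 1 or -1, l_0 + 2 l_1 + 2 l_2 = 0.

The trace T u = sigma u + sigma^-1 u preserves E_K, and
(l_0, l_1, l_2)(T u) = (2 l_1, l_0 + l_2, l_1 + l_2)(u). Since the logarithms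
determine a unit up to torsion, this gives T^2 = 1 - T (gal_trace_quad): E_K is
a module over Z[theta], where theta^2 + theta = 1. For any number alpha of
Z[theta], the real number N(l_0(u), l_0(T u)) is multiplied by the norm of alpha
when u is replaced by alpha u.

Part (1) says that E_K is free of rank 1 over Z[theta]. The argument is the one
that makes a Euclidean ring principal (Zbasis_of_norm_euclidean): a nontrivial
u_0 minimizing |N(l_0(u_0), l_0(T u_0))| generates E_K, because every unit is,
on the level of logarithms, a real multiple of u_0 by some alpha, and rounding
the coordinates of alpha leaves a remainder of norm at most 5/16. That the
minimum exists, and that the form vanishes only at 0, comes from a single unit v
with nonzero form: finitely many units have bounded logarithms
(bounded_units_finite), so by pigeonhole a fixed multiple of every unit lies in
Z[theta] v, and the values of the form are integer multiples of a fixed number.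

Such a v is supplied by Dirichlet's method (expanding_unit_exists). Pigeonhole
on integer combinations of an integral basis of K gives algebraic integers of
bounded norm, very small at iota and comparably large at the complex places; the
quotient of two of them that are congruent modulo a multiple of their norms is a
unit v with l_1(v), l_2(v) > 0, and then
N(l_0(v), l_0(T v)) = l_0^2 + 4 l_1 l_2 > 0.

For part (2), the rows of the regulator matrix are (l_0, 2 l_1, 2 l_2) up to
exchanging the last two columns. They sum to 0, so all minors agree up to sign,
and a change of Z-basis multiplies them by 1 or -1. On the basis u_0, T u_0 the
rows are (a, b, -a - b) and (b, a - b, -a) with a = l_0(u_0), b = l_0(T u_0), so
the minor is a (a - b) - b^2 = N(a, b). *)

Set Implicit Arguments.
Unset Strict Implicit.
Unset Printing Implicit Defensive.

Import Order.TTheory GRing.Theory Num.Theory.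

Local Open Scope ring_scope.
Local Open Scope quotient_scope.

(** * Modules over the norm-Euclidean ring generated by the golden ratio *)

(** This is the irrationality of the square root of 5: 4 N5 c d = (2 c - d)^2 -
5 d^2, so c and d vanish, as 5-adic valuations of nonzero squares are even. *)
Lemma N5_int_eq0 (c d : int) : N5 c d = 0 -> c = 0 /\ d = 0.
Proof.
move=> h.
have h5 : (`|(2 * c - d)%R| ^ 2 = 5 * `|d| ^ 2)%N.
  have : (2 * c - d) ^+ 2 = 5 * d ^+ 2 by move: h; rewrite /N5; lia.
  by move=> /(congr1 absz); rewrite abszM !abszX.
have d0 : d = 0.
  apply/eqP; rewrite -absz_eq0 -leqn0 leqNgt; apply/negP => dpos.
  have /(congr1 (logn 5)) := h5.
  rewrite lognM ?expn_gt0 ?dpos // !lognX (pfactorK 1) //.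
  by move/(congr1 odd); rewrite oddD !oddM.
by move: h; rewrite /N5 d0; split=> //; nia.
Qed.

Section Lattice.
Variables (R : realType) (A : zmodType).
Variables (T : {additive A -> A}) (ell : {additive A -> R}).

(** The norm form at the logarithms of u and T u. On the multiples of a fixed v
it is, up to the factor ell_form v, the norm of the multiplier. *)
Definition ell_form (u : A) : R := N5 (ell u) (ell (T u)).

(** The action of c + d theta on A, where theta acts as T. *)
Definition theta_act (c d : int) (u : A) : A := u *~ c + T u *~ d.

Hypothesis TT : forall u, T (T u) = u - T u.

Lemma ell_theta_act c d u : ell (theta_act c d u) = c%:~R * ell u + d%:~R * ell (T u).
Proof. by rewrite /theta_act raddfD !raddfMz !mulrzl. Qed.

Lemma ell_T_theta_act c d u :
  ell (T (theta_act c d u)) = c%:~R * ell (T u) + d%:~R * (ell u - ell (T u)).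
Proof. by rewrite /theta_act raddfD !raddfMz TT raddfD !raddfMz raddfB !mulrzl. Qed.

Lemma ell_form_theta_act c d u : ell_form (theta_act c d u) = (N5 c d)%:~R * ell_form u.
Proof.
rewrite /ell_form ell_theta_act ell_T_theta_act /N5 !rmorphB !rmorphXn rmorphM /=; ring.
Qed.

Lemma theta_actB c d c' d' u :
  theta_act c d u - theta_act c' d' u = theta_act (c - c') (d - d') u.
Proof. by rewrite /theta_act !mulrzBr opprD addrACA. Qed.

Lemma theta_act_mulrn c d u n :
  theta_act c d u *+ n = theta_act (c * n%:Z) (d * n%:Z) u.
Proof. by rewrite /theta_act mulrnDl !pmulrn !mulrzA. Qed.

Lemma half_round (p : R) : exists c : int, `|p - c%:~R| <= 1 / 2.
Proof.
exists (Num.floor (p + 1 / 2)).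
have h1 := ge_floor (p + 1 / 2).
have h2 := lt_succ_floor (p + 1 / 2).
rewrite intrD in h2; rewrite ler_norml; apply/andP; split; lra.
Qed.

(** Division with remainder by u. As ell_form u is the determinant of the pair
u, T u in logarithmic coordinates, every v has real coordinates on that pair,
and c, d are their nearest integers. The remainder v - theta_act c d u has
coordinates p, q. *)
Lemma euclid_div (u : A) : ell_form u != 0 -> forall v, exists c d (p q : R),
  [/\ `|p| <= 1 / 2, `|q| <= 1 / 2,
      ell (v - theta_act c d u) = p * ell u + q * ell (T u) &
      ell (T (v - theta_act c d u)) = p * ell (T u) + q * (ell u - ell (T u))].
Proof.
move=> Nu v; set a := ell u; set b := ell (T u).
have N0 : a ^+ 2 - a * b - b ^+ 2 != 0 by [].
set x := ell v; set y := ell (T v).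
pose p0 := (x * (a - b) - y * b) / (a ^+ 2 - a * b - b ^+ 2).
pose q0 := (y * a - x * b) / (a ^+ 2 - a * b - b ^+ 2).
have [c hc] := half_round p0; have [d hd] := half_round q0.
exists c, d, (p0 - c%:~R), (q0 - d%:~R); split => //.
  by rewrite raddfB ell_theta_act -/a -/b -/x /p0 /q0; field.
by rewrite raddfB /= raddfB ell_T_theta_act -/a -/b -/y /p0 /q0; field.
Qed.

Hypothesis ell_inj : forall u, ell u = 0 -> ell (T u) = 0 -> u = 0.
Hypothesis ell_fin : forall B : R, exists n, forall f : nat -> A,
  (forall i, `|ell (f i)| <= B /\ `|ell (T (f i))| <= B) ->
  exists i j, [/\ (i < j)%N, (j <= n)%N & f i = f j].

(** The remainders of v, 2 v, 3 v, ... modulo v0 lie in a bounded box, so two of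
the first few agree, and a factorial serves all v at once. *)
Lemma multiple_in_span v0 : ell_form v0 != 0 -> exists m, (0 < m)%N /\
  forall v, exists c d, v *+ m = theta_act c d v0.
Proof.
move=> N0; set a := ell v0; set b := ell (T v0).
have [n hn] := ell_fin (`|a| + `|b|).
(* n! is a multiple of every difference j - i with i < j <= n. *)
exists n`!; split; first exact: fact_gt0.
move=> v.
have /choice[g hg] : forall i, exists cd : int * int,
    `|ell (v *+ i - theta_act cd.1 cd.2 v0)| <= `|a| + `|b| /\
    `|ell (T (v *+ i - theta_act cd.1 cd.2 v0))| <= `|a| + `|b|.
  move=> i; have [c [d [p [q [hp hq e1 e2]]]]] := euclid_div N0 (v *+ i).
  have half (x y : R) : `|x| <= 1 / 2 -> `|x * y| <= `|y| / 2.
    by move=> hx; rewrite normrM mulrC ler_wpM2l //; lra.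
  have Ap := half p a hp; have Bp := half p b hp.
  have Bq := half q b hq; have Aq := half q (a - b) hq.
  have A0 := normr_ge0 a; have B0 := normr_ge0 b; have AB := ler_normB a b.
  exists (c, d); rewrite e1 e2 -/a -/b /=; split;
    by apply: le_trans (ler_normD _ _) _; lra.
have [i [j [ij jn e]]] := hn _ hg.
have {e} e : v *+ (j - i) = theta_act ((g j).1 - (g i).1) ((g j).2 - (g i).2) v0.
  rewrite -theta_actB mulrnBr ?(ltnW ij) //.
  have -> : v *+ j = v *+ i - theta_act (g i).1 (g i).2 v0 + theta_act (g j).1 (g j).2 v0.
    by rewrite e subrK.
  by rewrite addrAC [v *+ i - _]addrC addrK addrC.
have /dvdnP[k ->] : (j - i %| n`!)%N.
  by rewrite dvdn_fact // subn_gt0 ij (leq_trans (leq_subr _ _)).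
by rewrite mulnC mulrnA e theta_act_mulrn; do 2!eexists.
Qed.

(** A norm-Euclidean module is generated by an element of least norm. By
multiple_in_span the norms of nonzero elements are positive integer multiples of
a fixed number, so that a least one exists. *)
Theorem Zbasis_of_norm_euclidean v0 : ell_form v0 != 0 ->
  exists u0, is_Zbasis [tuple u0; T u0].
Proof.
move=> N0; have [m [m0 hm]] := multiple_in_span N0.
have mR : (0 : R) < m%:R by rewrite ltr0n.
(* Since m v = theta_act c d v0, the integer N5 c d measures the norm of v. *)
pose P (k : nat) :=
  `[< exists v, v <> 0 /\ `|ell_form v| * m%:R ^+ 2 = k%:R * `|ell_form v0| >].
have Pv v : v <> 0 ->
    exists2 k, (0 < k)%N & `|ell_form v| * m%:R ^+ 2 = k%:R * `|ell_form v0|.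
  move=> v0'; have [c [d e]] := hm v; exists `|N5 c d|%N.
    rewrite absz_gt0; apply/eqP => /N5_int_eq0[c0 d0].
    apply: v0'; move: e; rewrite c0 d0 /theta_act !mulr0z addr0 => e.
    apply: ell_inj.
      by apply/eqP; have /eqP := congr1 ell e; rewrite raddfMn raddf0 mulrn_eq0 gtn_eqF.
    apply/eqP; have /eqP := congr1 (ell \o T) e.
    by rewrite /= !raddfMn !raddf0 mulrn_eq0 gtn_eqF.
  have -> : `|ell_form v| * m%:R ^+ 2 = `|ell_form (v *+ m)|.
    rewrite /ell_form /N5 !raddfMn -(mulr_natr (ell v)) -(mulr_natr (ell (T v))).
    by rewrite -[m%:R ^+ 2]ger0_norm ?sqr_ge0// -normrM; congr `|_|; ring.
  by rewrite e ell_form_theta_act normrM natr_absz intr_norm.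
have exP : exists k, P k.
  have v00 : v0 <> 0.
    by move=> e; move: N0; rewrite /ell_form /N5 e !raddf0 expr0n mulr0 !subr0 eqxx.
  by have [k _ hk] := Pv _ v00; exists k; apply/asboolP; exists v0.
case: (ex_minnP exP) => k /asboolP[u0 [u00 hk]] kmin.
have N0R : 0 < `|ell_form v0| by rewrite normr_gt0.
have m2 : 0 < m%:R ^+ 2 :> R by rewrite exprn_gt0.
have Nu : ell_form u0 != 0.
  have [k' k'0 hk'] := Pv _ u00.
  apply/eqP => e; move: hk'; rewrite e normr0 mul0r => /esym/eqP.
  by rewrite mulf_eq0 pnatr_eq0 gtn_eqF // gt_eqF.
have gen v : exists c d, v = theta_act c d u0.
  have [c [d [p [q [hp hq e1 e2]]]]] := euclid_div Nu v.
  exists c, d; apply/eqP; rewrite -subr_eq0; apply/negPn/negP => /eqP w0.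
  set w := v - _ in e1 e2 w0.
  have [k' _ hk'] := Pv _ w0.
  have : (k <= k')%N by apply: kmin; apply/asboolP; exists w.
  apply/negP; rewrite -ltnNge -(ltr_nat R) -(ltr_pM2r N0R) -hk -hk' ltr_pM2r //.
  have -> : ell_form w = N5 p q * ell_form u0 by rewrite /ell_form e1 e2 /N5; ring.
  (* |p^2 - p q - q^2| <= 5/16 when |p|, |q| <= 1/2. *)
  rewrite normrM gtr_pMl ?normr_gt0 // /N5.
  move: hp hq; rewrite ltr_norml !ler_norml => /andP[? ?] /andP[? ?].
  by apply/andP; split; nra.
exists u0 => v; have [c [d ->]] := gen v.
have sumE (r : 'rV[int]_2) : \sum_(i < 2) tnth [tuple u0; T u0] i *~ r 0 i
    = theta_act (r 0 0) (r 0 1) u0.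
  rewrite big_ord_recl big_ord1 /theta_act; congr (_ *~ _ + _ *~ _).
  by congr (r _ _); apply: val_inj.
exists (\row_(i < 2) if i == 0 then c else d); split; first by rewrite sumE !mxE.
move=> r; rewrite sumE => /eqP; rewrite -subr_eq0 theta_actB => /eqP e.
have /eqP := congr1 ell_form e.
rewrite ell_form_theta_act [X in _ == X]/ell_form !raddf0 /N5 expr0n mulr0 !subr0.
rewrite mulf_eq0 (negbTE Nu) orbF.
rewrite intr_eq0 => /eqP/N5_int_eq0[/eqP]; rewrite subr_eq0 => /eqP -> /eqP.
rewrite subr_eq0 => /eqP ->; apply/rowP => i; rewrite !mxE.
by case: i => [[|[|//]]] hi /=; congr (r _ _); apply: val_inj.
Qed.

End Lattice.

(** * Algebraic integers of number fields *)

Section NumberField.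
Variable F : fieldExtType rat.

Lemma algint_int (n : int) : algint (n%:~R : F).
Proof. exact: integral_id. Qed.

Lemma num_field_intr_eq0 (n : int) : (n%:~R == 0 :> F) = (n == 0).
Proof. by rewrite -(rmorph_int (GRing.in_alg F)) fmorph_eq0 intr_eq0. Qed.

Lemma algintB (x y : F) : algint x -> algint y -> algint (x - y).
Proof. exact: integral_sub. Qed.

Lemma algintD (x y : F) : algint x -> algint y -> algint (x + y).
Proof. exact: integral_add. Qed.

Lemma algint_sum (I : Type) (r : seq I) (P : pred I) (x : I -> F) :
  (forall i, P i -> algint (x i)) -> algint (\sum_(i <- r | P i) x i).
Proof.
by move=> h; apply: (big_ind (@algint F)) => //; [exact: integral0|exact: algintD].
Qed.

(** Integrality descends to the rationals, and there Gauss gives an integer. *)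
Lemma rational_algint (x : F) : x \in 1%VS -> algint x -> exists n : int, x = n%:~R.
Proof.
move=> /vlineP[a ->] [p mon_p pa].
have pa' : root (map_poly intr p : {poly rat}) a.
  rewrite -(fmorph_root (GRing.in_alg F)) -map_poly_comp.
  by rewrite (eq_map_poly (rmorph_int _)).
have : (ratr a : algC) \in Aint.
  apply: (@root_monic_Aint (map_poly intr p)).
  - rewrite -(eq_map_poly (rmorph_int (ratr : rat -> algC))) map_poly_comp.
    by rewrite fmorph_root.
  - exact: monic_map.
  - by apply/polyOverP => i; rewrite coef_map /= intr_int.
move/Cint_rat_Aint => /(_ (Crat_rat a)); rewrite Cint_rat => /intrP[n ->].
by exists n; rewrite -(rmorph_int (GRing.in_alg F)).
Qed.

(** If x is a root of an integer polynomial p of degree n with leading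
coefficient l, then l x is a root of the monic polynomial l^(n-1) p(X / l). *)
Lemma algint_multiple (x : F) : exists2 d : nat, (0 < d)%N & algint (d%:R * x).
Proof.
have [q minq] := polyOver1P (minPolyOver 1 x).
have q0 : q != 0.
  by have := monic_neq0 (monic_minPoly 1 x); rewrite minq map_poly_eq0.
have rq : root (map_poly (GRing.in_alg F) q) x by rewrite -minq root_minPoly.
have [p [a a0 def_q]] := rat_poly_scale q.
have rp : root (map_poly intr p) x.
  have : map_poly (GRing.in_alg F) q
      = (GRing.in_alg F a%:~R)^-1 *: map_poly intr p :> {poly F}.
    rewrite def_q map_polyZ fmorphV -map_poly_comp; congr (_ *: _).
    by apply: eq_map_poly => n; exact: rmorph_int.
  by move=> e; move: rq; rewrite e rootZ // invr_eq0 fmorph_eq0 intr_eq0.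
have p0 : p != 0.
  by apply: contraNneq q0 => p0; rewrite def_q p0 map_poly0 scaler0.
pose l := lead_coef p.
have l0 : l != 0 by rewrite lead_coef_eq0.
have sp : (1 < size p)%N.
  rewrite ltnNge; apply/negP => /size1_polyC e.
  move: rp; rewrite e map_polyC rootC num_field_intr_eq0 => /eqP c0.
  by move: p0; rewrite e c0 eqxx.
pose m := (size p).-2.
have szp : size p = m.+2 by rewrite /m; case: (size p) sp => [|[]].
pose r : {poly int} :=
  \poly_(i < m.+2) (if i == m.+1 then 1 else p`_i * l ^+ (m - i)).
have lr : algint (l%:~R * x).
  exists r.
    by apply/monicP; rewrite lead_coef_poly //= ?eqxx ?oner_eq0.
  rewrite /root (horner_coef_wide _ (leq_trans (size_poly _ _) (size_poly _ _))).
  have : (l%:~R ^+ m : F) * (map_poly intr p).[x] = 0 by rewrite (rootP rp) mulr0.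
  rewrite horner_coef size_map_poly_id0; last first.
    by rewrite num_field_intr_eq0 lead_coef_eq0.
  rewrite szp big_distrr /= => e0; apply/eqP; rewrite -[RHS]e0; apply: eq_bigr => i _.
  rewrite !coef_map coef_poly ltn_ord exprMn /=.
  case: eqP => [e|/eqP ne].
    have -> : p`_i = l by rewrite /l lead_coefE szp e.
    by rewrite e rmorph1 mul1r exprSr -!mulrA.
  have im : (i <= m)%N by have := ltn_ord i; rewrite ltnS leq_eqVlt (negPf ne).
  rewrite rmorphM rmorphXn /= -[in X in _ = X * _](subnK im) exprD.
  by ring.
exists `|l|%N; first by rewrite absz_gt0.
(* The lemma asks for a natural number, and l may be negative. *)
have -> : (`|l|%:R : F) = (sgz l)%:~R * l%:~R.
  by rewrite -intrM -abszEsg.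
by rewrite -mulrA; apply: algintM lr; apply: algint_int.
Qed.

Lemma num_field_separable (K E : {subfield F}) : separable K E.
Proof.
apply/separableP => y _; apply: pcharf0_separable => p.
by rewrite (fmorph_pchar (GRing.in_alg F)) pchar_num.
Qed.

Lemma num_field_PET (E : {subfield F}) :
  exists2 z, z \in E & E = <<1; z>>%VS :> {vspace F}.
Proof.
exists (separable_generator 1 E); first exact: separable_generator_mem.
by apply: eq_adjoin_separable_generator; rewrite ?num_field_separable ?sub1v.
Qed.

(** Rational polynomials in a primitive element exhaust the field, so that an
embedding is determined by its value at z. *)
Lemma PET_rat_poly (E : {subfield F}) z x : E = <<1; z>>%VS :> {vspace F} -> x \in E ->
  exists q : {poly rat}, x = (map_poly (GRing.in_alg F) q).[z].
Proof.
move=> -> xE; have [q e] := polyOver1P (Fadjoin_polyOver 1 z x).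
by exists q; rewrite -e Fadjoin_poly_eq.
Qed.

End NumberField.

Lemma algint_subvs (F : fieldExtType rat) (K : {subfield F}) (x : subvs_of K) :
  algint (vsval x) -> algint x.
Proof.
move=> [p mon_p px]; exists p => //.
move: px; rewrite -(fmorph_root (vsval : {rmorphism subvs_of K -> F})) -map_poly_comp.
by rewrite (eq_map_poly (rmorph_int _)).
Qed.

(** A Q-basis of V made of algebraic integers; it need not span the integers of
V over Z. *)
Record integral_basis (F : fieldExtType rat) (V : {vspace F}) (n : nat)
    (e : 'I_n -> F) : Prop := IntegralBasis {
  ibasis_mem : forall i, e i \in V;
  ibasis_int : forall i, algint (e i);
  ibasis_span : forall z, z \in V -> exists q : 'I_n -> rat, z = \sum_i q i *: e i;
  ibasis_free : forall q : 'I_n -> rat, \sum_i q i *: e i = 0 -> forall i, q i = 0 }.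

Lemma integral_basis_exists (F : fieldExtType rat) (V : {vspace F}) :
  exists e : 'I_(\dim V) -> F, integral_basis V e.
Proof.
pose b := vbasis V.
have bV : basis_of V b := vbasisP V.
have /choice[d dP] (i : 'I_(\dim V)) : exists d : rat, d != 0 /\ algint (d *: b`_i).
  have [d d0 h] := algint_multiple b`_i; exists d%:R; split.
    by rewrite pnatr_eq0 -lt0n.
  by rewrite -[X in algint X]mulr_algl scaler_nat.
have d0 i : d i != 0 by have [] := dP i.
exists (fun i => d i *: b`_i); split.
- by move=> i; rewrite memvZ // (basis_mem bV) // mem_nth // size_tuple.
- by move=> i; have [] := dP i.
- move=> z zV; exists (fun i => coord b i z / d i).
  rewrite {1}(coord_basis bV zV); apply: eq_bigr => i _.
  by rewrite scalerA divfK.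
move=> q e i; have /freeP := basis_free bV.
move/(_ (fun i => q i * d i)) => h.
have : q i * d i = 0.
  by apply: h; rewrite -[RHS]e; apply: eq_bigr => j _; rewrite scalerA.
by move/eqP; rewrite mulf_eq0 (negPf (d0 i)) orbF => /eqP.
Qed.

(** * Complex embeddings of number fields *)

Lemma num_field_rmorph_alg (F F' : fieldExtType rat) (f : {rmorphism F -> F'}) a :
  f (a%:A) = a%:A.
Proof. by rewrite !alg_num_field fmorph_rat. Qed.

Lemma num_field_rmorph_horner (F F' : fieldExtType rat) (f : {rmorphism F -> F'}) q z :
  f (map_poly (GRing.in_alg F) q).[z] = (map_poly (GRing.in_alg F') q).[f z].
Proof.
rewrite -horner_map -map_poly_comp; congr (_.[_]).
by apply: eq_map_poly => a; exact: num_field_rmorph_alg.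
Qed.

Section Embeddings.
Variable C : numClosedFieldType.

Lemma num_field_rmorph_ratr (F : fieldExtType rat) (f : {rmorphism F -> C}) a :
  f (a%:A) = ratr a.
Proof. by rewrite alg_num_field fmorph_rat. Qed.

Lemma rmorph_rat_horner (F : fieldExtType rat) (f : {rmorphism F -> C}) q z :
  f (map_poly (GRing.in_alg F) q).[z] = (map_poly ratr q).[f z].
Proof.
rewrite -horner_map -map_poly_comp; congr (_.[_]).
by apply: eq_map_poly => a; exact: num_field_rmorph_ratr.
Qed.

(** A primitive element b is sent to any complex root z of its minimal
polynomial: x = q(b) goes to q(z), which does not depend on q since the minimal
polynomial divides any rational polynomial that vanishes at b. *)
Lemma num_field_embedding (L : fieldExtType rat) : inhabited {rmorphism L -> C}.
Proof.
have [b _ defL] := num_field_PET {:L}.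
have [p minp] := polyOver1P (minPolyOver 1 b).
have [z rz] : exists z : C, root (map_poly ratr p) z.
  apply/closed_rootP; rewrite size_map_poly.
  by rewrite -(size_map_poly (GRing.in_alg L)) -minp size_minPoly.
have key q : root (map_poly (GRing.in_alg L) q) b ->
    root (map_poly (ratr : rat -> C) q) z.
  move=> rq; have := minPoly_dvdp (alg_polyOver 1 q) rq.
  rewrite minp dvdp_map => dpq; apply: root_dvdp rz.
  by rewrite dvdp_map.
have /choice[q qE] (x : L) := PET_rat_poly defL (memvf x).
pose f (x : L) : C := (map_poly ratr (q x)).[z].
have eqf (x : L) r : x = (map_poly (GRing.in_alg L) r).[b] -> f x = (map_poly ratr r).[z].
  move=> xr; apply/eqP; rewrite -subr_eq0 -hornerN -hornerD -rmorphB; apply: key.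
  by rewrite /root rmorphB hornerD hornerN -qE -xr subrr.
have fB : zmod_morphism f.
  move=> x y; rewrite (eqf _ (q x - q y)) ?rmorphB ?hornerD ?hornerN //.
  by rewrite -!qE.
have fM : monoid_morphism f.
  split; first by rewrite (eqf _ 1) ?rmorph1 ?hornerC.
  by move=> x y; rewrite (eqf _ (q x * q y)) ?rmorphM ?hornerM // -!qE.
pose fBm := GRing.isZmodMorphism.Build _ _ f fB.
pose fMm := GRing.isMonoidMorphism.Build _ _ f fM.
exact: inhabits (HB.pack f fBm fMm : {rmorphism L -> C}).
Qed.

(** The minimal polynomial of a primitive element b of M splits in L as the
product of the X - g b, so rho b, being one of its roots, is some J (g b). *)
Lemma embedding_gal (L : splittingFieldType rat) (M : {subfield L})
    (J : {rmorphism L -> C}) (rho : {rmorphism subvs_of M -> C}) :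
  galois 1 {:L} ->
  exists2 g, g \in 'Gal({:L} / 1)%g & forall x, rho x = J (g (vsval x)).
Proof.
move=> galL; have [b bM defM] := num_field_PET M.
have /(galois_factors (sub1v _)) fac := galL.
have [r [/subsetP rG _]] := fac b (memvf b); rewrite big_map => minb.
have [p minp] := polyOver1P (minPolyOver 1 b).
pose b' := Subvs bM.
have : root (map_poly ratr p) (rho b').
  rewrite /root -rmorph_rat_horner fmorph_eq0; apply/eqP/val_inj.
  rewrite (num_field_rmorph_horner (vsval : {rmorphism subvs_of M -> L})) -minp.
  exact/rootP/root_minPoly.
have -> : map_poly ratr p = \prod_(g <- r) ('X - (J (g b))%:P).
  have -> : map_poly ratr p = map_poly J (map_poly (GRing.in_alg L) p).
    by rewrite -map_poly_comp; apply: eq_map_poly => a /=; rewrite num_field_rmorph_ratr.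
  rewrite -minp minb rmorph_prod; apply: eq_bigr => g _.
  by rewrite rmorphB /= map_polyX map_polyC.
rewrite /root horner_prod prodf_seq_eq0 => /hasP[g gr].
rewrite /= hornerXsubC subr_eq0 => /eqP e.
exists g; first exact: rG.
move=> x; have [q xq] := PET_rat_poly defM (valP x).
have {1}-> : x = (map_poly (GRing.in_alg _) q).[b'].
  apply: val_inj; rewrite (num_field_rmorph_horner (vsval : {rmorphism subvs_of M -> L})).
  exact: xq.
rewrite rmorph_rat_horner e -rmorph_rat_horner; congr (J _).
by rewrite -(num_field_rmorph_horner (g : {rmorphism L -> L})) [vsval x]xq.
Qed.

End Embeddings.

(** * The Galois group *)

Section GaloisGroup.
Variables (L : splittingFieldType rat) (K : {subfield L}).
Hypothesis hK : D5_extension K.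
Variables sigma c : gal_of {:L}.
Hypotheses (Gsigma : sigma \in 'Gal({:L} / 1)%g) (ord_sigma : #[sigma]%g = 5%N).
Hypotheses (c_neq1 : c != 1%g) (cc : (c * c = 1)%g).
Hypothesis cK : forall x, x \in K -> c x = x.

Let galL : galois 1 {:L}. Proof. by case: hK => _ []. Qed.
Let galKL : galois K {:L}.
Proof. by apply: galoisS galL; rewrite sub1v subvf. Qed.

Let card_G : #|'Gal({:L} / 1)%g| = 10%N.
Proof.
case: hK => _ _ iso; rewrite (card_isog iso).
exact: (@card_dihedral 5).
Qed.

Let dimL : \dim {:L} = 10%N.
Proof. by rewrite -card_G -galois_dim // dimv1 divn1. Qed.

Let card_H : #|'Gal({:L} / K)%g| = 2%N.
Proof. by rewrite -galois_dim // dimL; case: hK => ->. Qed.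

Let cH : c \in 'Gal({:L} / K)%g.
Proof.
rewrite gal_kHom ?subvf //; apply/kAHomP => x xK; exact: cK.
Qed.

Let Gc : c \in 'Gal({:L} / 1)%g.
Proof. by apply: subsetP cH; apply: galS; apply: sub1v. Qed.

Let ord_c : #[c]%g = 2%N.
Proof.
apply/prime_nt_dvdP => //; last by rewrite order_dvdn expgS expg1 cc.
by rewrite order_eq1.
Qed.

Let H_c : 'Gal({:L} / K)%g = <[c]>%g.
Proof.
apply/esym/eqP; rewrite eqEcard cycle_subG cH card_H.
by rewrite -[#|_|]/(#[c]%g) ord_c.
Qed.

Let G_prod : (<[c]> * <[sigma]>)%g = 'Gal({:L} / 1)%g.
Proof.
apply/eqP; rewrite eqEcard mul_subG ?cycle_subG //=.
rewrite coprime_cardMg -?[#|<[_]>%g|]/(#[_]%g) ord_c ord_sigma ?card_G //.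
Qed.

(** Both <[c]> and Gal(L/K) have order 2, so they are equal. *)
Lemma fixed_by_c x : c x = x -> x \in K.
Proof.
move=> cx; have /galois_fixedField <- := galKL.
apply/fixedFieldP; rewrite ?memvf // => g; rewrite H_c => /cycleP[n ->].
elim: n => [|n IH]; first by rewrite expg0 gal_id.
by rewrite expgS galM ?memvf // cx.
Qed.

(** The subgroups generated by c and sigma have coprime orders 2 and 5, so
together they fill the group of order 10. *)
Lemma fixed_by_sigma_c x : sigma x = x -> c x = x -> x \in 1%VS.
Proof.
have fix_expg (g : gal_of {:L}) n : g x = x -> (g ^+ n)%g x = x.
  move=> gx; elim: n => [|n IH]; first by rewrite expg0 gal_id.
  by rewrite expgS galM ?memvf // gx.
move=> sx cx; have /galois_fixedField <- := galL.
apply/fixedFieldP; rewrite ?memvf // => g.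
rewrite -G_prod => /mulsgP[_ _ /cycleP[i ->] /cycleP[j ->] ->].
by rewrite galM ?memvf // !fix_expg.
Qed.

(** Every g is a power of c followed by a power of sigma, and c is the identity
on K. *)
Lemma gal_restrict g : g \in 'Gal({:L} / 1)%g ->
  exists2 k, (k < 5)%N & forall x, x \in K -> g x = (sigma ^+ k)%g x.
Proof.
rewrite -G_prod => /mulsgP[a _ ca /cycleP[j ->] ->].
exists (j %% 5)%N; first by rewrite ltn_mod.
move=> x xK; rewrite galM ?memvf // -ord_sigma expg_mod_order.
by rewrite -H_c in ca; rewrite (fixed_gal _ ca) ?subvf.
Qed.

(** Otherwise an element of order 5 would lie in Gal(L/K), which has order 2. *)
Lemma sigma_not_fix k : ~~ (5 %| k)%N -> exists2 x, x \in K & (sigma ^+ k)%g x != x.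
Proof.
move=> k5; apply: contrapT => h.
have : (sigma ^+ k)%g \in 'Gal({:L} / K)%g.
  rewrite gal_kHom ?subvf //; apply/kAHomP => x xK; apply/eqP.
  by apply: contrapT => /negP ne; apply: h; exists x.
move/order_dvdG; rewrite card_H orderXgcd ord_sigma.
have -> : gcdn 5 k = 1%N by apply/eqP; rewrite -/(coprime 5 k) prime_coprime.
by [].
Qed.

(** The subgroup generated by sigma has index 2, so c sigma c = sigma^i with i^2
congruent to 1 modulo 5. If i = 1 then Gal(L/K) = <[c]> would be normal, so K
would be Galois over Q and equal to its Galois closure L. *)
Lemma c_sigma x : c (sigma x) = (sigma^-1)%g (c x).
Proof.
have nS : (<[sigma]> <| 'Gal({:L} / 1))%g.
  apply: index2_normal; first by rewrite cycle_subG.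
  by rewrite -divgS ?cycle_subG // card_G -[#|<[_]>%g|]/(#[_]%g) ord_sigma.
have cV : (c^-1 = c)%g by apply/eqP; rewrite eq_invg_mul cc.
have : (sigma ^ c \in <[sigma]>)%g.
  by rewrite memJ_norm ?cycle_id // (subsetP (normal_norm nS)).
case/cycleP => i sc.
have : ((sigma ^+ (i * i))%g == (sigma ^+ 1)%g).
  by rewrite expgM -sc -conjXg -sc -conjgM cc conjg1.
rewrite eq_expg_mod_order ord_sigma -modnMm => hi.
have : (i %% 5 == 1)%N || (i %% 5 == 4)%N.
  by move: hi; have := ltn_pmod i (isT : 0 < 5)%N; move: (i %% 5)%N; do 5?[case=>//].
case/orP => /eqP i5.
  have sc1 : (sigma ^ c = sigma)%g.
    by rewrite sc -(expg_mod_order sigma) ord_sigma i5.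
  have nc : (<[c]> <| 'Gal({:L} / 1))%g.
    apply/andP; split; first by rewrite cycle_subG.
    rewrite -G_prod mul_subG ?normG // cycle_subG; apply/normP.
    rewrite -cycleJ; congr (<[_]>)%g.
    by apply/conjg_fixP/commgP/commute_sym/commgP/conjg_fixP.
  have galK : galois 1 K.
    have := normal_fixedField_galois galL nc.
    by rewrite /= -H_c; have /galois_fixedField -> := galKL.
  case: hK => dK [_ /(_ K (subvv K) galK) eK] _.
  by have := congr1 (fun V : {vspace L} => \dim V) eK; rewrite /= dK dimL.
have sc1 : (sigma ^ c = sigma^-1)%g.
  rewrite sc -(expg_mod_order sigma) ord_sigma i5.
  by apply/eqP; rewrite eq_sym eq_invg_mul -expgS -ord_sigma expg_order.
rewrite -!galM ?memvf //; congr ((_ : gal_of _) x).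
by rewrite -sc1 conjgE cV !mulgA cc mul1g.
Qed.

Lemma sigma5 x : (sigma ^+ 5)%g x = x.
Proof. by rewrite -ord_sigma expg_order gal_id. Qed.

End GaloisGroup.

Lemma real_valued_embedding (R : realType) (F : fieldExtType rat)
    (f : {rmorphism F -> R[i]}) : (forall x, complex.Im (f x) = 0) ->
  exists f' : {rmorphism F -> R}, forall x, f x = real_complex R (f' x).
Proof.
move=> f0; pose g x := complex.Re (f x).
have gE x : f x = real_complex R (g x).
  by rewrite [LHS]complexE f0 mulr0 addr0.
have gB : zmod_morphism g.
  by move=> x y; apply: complexI; rewrite -gE !rmorphB !gE.
have gM : monoid_morphism g.
  by split=> [|x y]; apply: complexI; rewrite -gE ?rmorph1 // !rmorphM !gE.
pose gBm := GRing.isZmodMorphism.Build _ _ g gB.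
pose gMm := GRing.isMonoidMorphism.Build _ _ g gM.
by exists (HB.pack g gBm gMm : {rmorphism F -> R}).
Qed.

Lemma conjc_fixed_Im (R : realType) (z : R[i]) : z = conjc z -> complex.Im z = 0.
Proof. by case: z => a b [] /= h; lra. Qed.

(** J is an embedding of L extending iota, and c is complex conjugation
transported to L. The fields gather what the arithmetic of K uses about the two
of them; sigma_nonreal says that J sigma^k takes non-real values on K unless 5
divides k. *)
Record conj_embedding (R : realType) (L : splittingFieldType rat) (K : {subfield L})
    (iota : {rmorphism subvs_of K -> R}) (sigma : gal_of {:L})
    (J : {rmorphism L -> R[i]}) (c : gal_of {:L}) : Prop := ConjEmbedding {
  J_iota : forall x : subvs_of K, J (vsval x) = real_complex R (iota x);
  J_c : forall x, J (c x) = conjc (J x);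
  c_fixed : forall x, c x = x <-> x \in K;
  c_sigma_conj : forall x, c (sigma x) = (sigma^-1)%g (c x);
  sigma_pow5 : forall x, (sigma ^+ 5)%g x = x;
  fixed_rational : forall x, sigma x = x -> c x = x -> x \in 1%VS;
  sigma_nonreal : forall k, ~~ (5 %| k)%N ->
    exists x : subvs_of K, complex.Im (J ((sigma ^+ k)%g (vsval x))) != 0;
  embeddings_K : forall rho : {rmorphism subvs_of K -> R[i]},
    exists2 k, (k < 5)%N & forall x, rho x = J ((sigma ^+ k)%g (vsval x)) }.

(** Both the real embedding iota and the conjugate of J are obtained from one
embedding of L by composing with a Galois automorphism (embedding_gal). If J
sigma^k were real on K, it would equal iota by uniqueness and sigma^k would fix
K; in particular c = 1 is impossible, for then J sigma would be real. *)
Lemma conj_embedding_exists (R : realType) (L : splittingFieldType rat)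
    (K : {subfield L}) (hK : D5_extension K)
    (iota : {rmorphism subvs_of K -> R}) (hiota : unique_real_embedding iota)
    (sigma : gal_of {:L}) (hsigma : sigma \in 'Gal({:L} / 1)%g)
    (ord_sigma : #[sigma]%g = 5%N) :
  exists J c, conj_embedding iota sigma J c.
Proof.
have galL : galois 1 {:L} by case: hK => _ [].
have [J0] := num_field_embedding R[i] L.
have [g0 _ Jg0] := embedding_gal J0 (real_complex R \o iota) galL.
pose J : {rmorphism L -> R[i]} := J0 \o g0.
have Jiota x : J (vsval x) = real_complex R (iota x) by rewrite /= -Jg0.
pose Jbar : {rmorphism subvs_of {:L} -> R[i]} :=
  @conjc R \o J \o (vsval : {rmorphism subvs_of {:L} -> L}).
have [c Gc Jc'] := embedding_gal J Jbar galL.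
have Jc x : J (c x) = conjc (J x) by have := Jc' (Subvs (memvf x)).
have cK x : x \in K -> c x = x.
  move=> xK; apply: (fmorph_inj J); rewrite Jc.
  by rewrite -[x]/(vsval (Subvs xK)) Jiota; exact: conjc_real.
have cc : (c * c = 1)%g.
  apply/eqP/gal_eqP => x _; rewrite galM ?memvf // gal_id.
  by apply: (fmorph_inj J); rewrite !Jc conjcK.
have real_fix (g : gal_of {:L}) :
    (forall x : subvs_of K, complex.Im (J (g (vsval x))) = 0) ->
    forall x, x \in K -> g x = x.
  move=> h; pose f : {rmorphism subvs_of K -> R[i]} :=
    J \o g \o (vsval : {rmorphism subvs_of K -> L}).
  have [f' ff'] := real_valued_embedding (f := f) h.
  move=> x xK; apply: (fmorph_inj J).
  by have := ff' (Subvs xK); rewrite (hiota f') -Jiota.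
have nonreal k : ~~ (5 %| k)%N ->
    exists x : subvs_of K, complex.Im (J ((sigma ^+ k)%g (vsval x))) != 0.
  move=> k5; apply: contrapT => h.
  have [x xK /eqP[]] := sigma_not_fix hK ord_sigma k5.
  apply: real_fix xK => y; apply/eqP; apply: contrapT => /negP ne.
  by apply: h; exists y.
have c1 : c != 1%g.
  apply/eqP => c1; have [x /eqP[]] := nonreal 1%N isT.
  by apply: conjc_fixed_Im; rewrite -Jc c1 gal_id.
exists J, c; split=> //.
- move=> x; split; first exact: (fixed_by_c hK c1 cc cK).
  exact: cK.
- exact: (c_sigma hK hsigma ord_sigma c1 cc cK).
- exact: (sigma5 ord_sigma).
- exact: (fixed_by_sigma_c hK hsigma ord_sigma c1 cc cK).
move=> rho; have [g Gg rhoE] := embedding_gal J rho galL.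
have [k k5 gE] := gal_restrict hK hsigma ord_sigma c1 cc cK Gg.
by exists k => // x; rewrite rhoE gE // (valP x).
Qed.

(** * Pigeonhole principles and elementary inequalities *)

Lemma pigeonhole_nat (T : finType) (g : nat -> T) :
  exists i j, [/\ (i < j)%N, (j <= #|T|)%N & g i = g j].
Proof.
apply: contrapT => h.
have inj : injective (fun i : 'I_(#|T|.+1) => g i).
  move=> i j gij; apply/val_inj; apply: contrapT => /eqP.
  rewrite neq_ltn => /orP[] lt; apply: h.
    by exists i, j; split=> //; rewrite -ltnS ltn_ord.
  by exists j, i; split=> //; rewrite -ltnS ltn_ord.
by have := leq_card _ inj; rewrite card_ord ltnn.
Qed.

(** Cut the interval from -B to B into m boxes, plus one for the right end
point. *)
Lemma real_pigeonhole (R : realType) (T : finType) (v : T -> R) (B : R) (m : nat) :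
  0 < B -> (0 < m)%N -> (m.+1 < #|T|)%N -> (forall t, `|v t| <= B) ->
  exists t t', t != t' /\ `|v t - v t'| * m%:R <= 2 * B.
Proof.
move=> B0 m0 mT vB; have mR : (0 : R) < m%:R by rewrite ltr0n.
pose w t := (v t + B) * m%:R / (2 * B).
have w0 t : 0 <= w t.
  have := vB t; rewrite ler_norml => /andP[? ?].
  by rewrite divr_ge0 ?mulr_ge0 ?ler0n //; lra.
have wm t : w t <= m%:R.
  have := vB t; rewrite ler_norml => /andP[? ?].
  by rewrite ler_pdivrMr ?mulr_gt0 // mulrC ler_pM2l //; lra.
have gm t : (Num.truncn (w t) < m.+1)%N.
  by rewrite truncn_lt_nat // (le_lt_trans (wm t)) // ltr_nat.
pose g t : 'I_m.+1 := Ordinal (gm t).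
have [t [t' [tt' gtt']]] : exists t t', t != t' /\ g t = g t'.
  apply: contrapT => h; have inj : injective g.
    move=> t t' e; apply: contrapT => /eqP ne; apply: h; by exists t, t'.
  by have := leq_card g inj; rewrite card_ord leqNgt mT.
exists t, t'; split=> //.
have /andP[a1 a2] := truncn_itv (w0 t); have /andP[b1 b2] := truncn_itv (w0 t').
have e : Num.truncn (w t) = Num.truncn (w t') := congr1 val gtt'.
rewrite e in a1 a2; rewrite -natr1 in a2 b2.
have : `|w t - w t'| <= 1 by rewrite ler_norml; apply/andP; split; lra.
have -> : w t - w t' = (v t - v t') * (m%:R / (2 * B)) by rewrite /w; field; lra.
rewrite normrM (@ger0_norm _ (m%:R / _)) ?divr_ge0 ?ler0n //; last by lra.
by rewrite mulrA ler_pdivrMr ?mul1r //; lra.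
Qed.

(** If a product of three factors is at least 1, upper bounds on two of them
bound the third from below. Here a, p, r stand for the absolute value of an
algebraic integer at the real place and for its squares at the complex places.
*)
Lemma middle_factor_ge (R : realType) (a p r Q T : R) :
  0 < Q -> 0 < T -> 0 <= a -> 0 <= p -> 0 <= r ->
  1 <= a * p * r -> a * Q ^+ 4 <= 2 * T -> r <= T ^+ 2 * Q ^+ 2 ->
  Q ^+ 2 <= 2 * T ^+ 3 * p.
Proof.
move=> Q0 T0 a0 p0 r0 h1 h2 h3.
have Q2 : 0 < Q ^+ 2 by rewrite exprn_gt0.
rewrite -(ler_pM2r Q2).
have : Q ^+ 2 * Q ^+ 2 <= (a * Q ^+ 4) * (p * r).
  have -> : (a * Q ^+ 4) * (p * r) = (Q ^+ 2 * Q ^+ 2) * (a * p * r) by ring.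
  by rewrite ler_peMr // mulr_ge0 // ltW.
move=> h; apply: le_trans h _.
have -> : 2 * T ^+ 3 * p * Q ^+ 2 = (2 * T) * (p * (T ^+ 2 * Q ^+ 2)) by ring.
apply: ler_pM => //; first by rewrite mulr_ge0 // exprn_ge0 // ltW.
  by rewrite mulr_ge0.
by rewrite ler_wpM2l.
Qed.

(** Two generators of a cyclic subgroup of R agree up to sign. *)
Lemma eq_norm_int_multiples (R : realType) (x y : R) (d d' : int) :
  x = d%:~R * y -> y = d'%:~R * x -> `|x| = `|y|.
Proof.
move=> xy yx; have [y0|y0] := eqVneq y 0; first by rewrite xy y0 mulr0.
have : (d * d')%:~R * y = 1 * y by rewrite mul1r {2}yx xy intrM; ring.
move/(mulIf y0)/eqP; rewrite -[1]/(1%:~R) eqr_int => /eqP/(congr1 absz)/eqP.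
rewrite abszM muln_eq1 => /andP[/eqP d1 _].
by rewrite xy normrM -intr_norm -abszE d1 mul1r.
Qed.

Lemma det_mx2 (R : comNzRingType) (M : 'M[R]_2) :
  \det M = M 0 0 * M 1 1 - M 0 1 * M 1 0.
Proof.
rewrite (expand_det_row _ 0) big_ord_recl big_ord1 /cofactor !det_mx11 !mxE /=.
rewrite expr0 expr1 mul1r mulN1r mulrN.
by congr (_ * M _ _ - M _ _ * M _ _); apply: val_inj.
Qed.

Lemma Zbasis2_coord (A : zmodType) (b : 2.-tuple A) : is_Zbasis b ->
  forall a, exists p q : int, a = tnth b 0 *~ p + tnth b 1 *~ q.
Proof.
move=> hb a; have [r [-> _]] := hb a.
exists (r 0 0), (r 0 1); rewrite big_ord_recl big_ord1.
by congr (_ + tnth b _ *~ r _ _); apply: val_inj.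
Qed.

(** * Absolute values and logarithms *)

Section Normc.
Variable R : realType.
Implicit Types z : R[i].

Lemma normc_ge0 z : 0 <= Normc.normc z.
Proof. by case: z => a b; rewrite sqrtr_ge0. Qed.

Lemma normc_eq0 z : (Normc.normc z == 0) = (z == 0).
Proof. by apply/eqP/eqP => [/Normc.eq0_normc //|->]; exact: Normc.normc0. Qed.

Lemma normc_conj z : Normc.normc (conjc z) = Normc.normc z.
Proof. by case: z => a b; rewrite /= sqrrN. Qed.

Lemma normc_real (a : R) : Normc.normc (real_complex R a) = `|a|.
Proof. by rewrite /= expr0n addr0 sqrtr_sqr. Qed.

Lemma normc_int (n : int) : Normc.normc (n%:~R : R[i]) = `|n%:~R|.
Proof. by rewrite -normc_real rmorph_int. Qed.

Lemma normc_sum (I : Type) (r : seq I) (z : I -> R[i]) :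
  Normc.normc (\sum_(i <- r) z i) <= \sum_(i <- r) Normc.normc (z i).
Proof.
elim: r => [|i r IH]; first by rewrite !big_nil Normc.normc0.
by rewrite !big_cons (le_trans (le_normcD _ _)) // lerD2l.
Qed.

End Normc.

Section LogComplex.
Variables (R : realType) (F : fieldExtType rat) (tau : {rmorphism F -> R[i]}).

Lemma normc_unit_gt0 (u : Ounits F) : 0 < Normc.normc (tau (\val u)).
Proof. by rewrite lt_def normc_ge0 normc_eq0 fmorph_eq0 (Ounit_neq0 (valP u)). Qed.

Fact log_complex_zmod : zmod_morphism (log_complex tau).
Proof.
move=> u v; rewrite -[u]reprK -[v]reprK -raddfB !log_complex_pi /=.
rewrite rmorphM fmorphV Normc.normcM Normc.normcV.
by rewrite ln_div // posrE normc_unit_gt0.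
Qed.

HB.instance Definition _ :=
  GRing.isZmodMorphism.Build (Egroup F) R (log_complex tau) log_complex_zmod.
End LogComplex.

(** * Conjugates, trace and norm of elements of K *)

Section Conjugates.
Variables (R : realType) (L : splittingFieldType rat) (K : {subfield L}).
Variables (iota : {rmorphism subvs_of K -> R}) (sigma : gal_of {:L}).
Variables (J : {rmorphism L -> R[i]}) (c : gal_of {:L}).
Hypothesis D : conj_embedding iota sigma J c.

Definition sigma_iter k (x : L) : L := (sigma ^+ k)%g x.
Definition absv k (x : L) : R := Normc.normc (J (sigma_iter k x)).

Local Notation s := sigma_iter.

Lemma sigma_iter_0 x : s 0 x = x. Proof. by rewrite /s expg0 gal_id. Qed.

Lemma sigma_iter_1 x : s 1 x = sigma x. Proof. by rewrite /s expg1. Qed.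

Lemma sigma_iter_add j k x : s j (s k x) = s (j + k) x.
Proof. by rewrite /s -galM ?memvf // -expgD addnC. Qed.

Lemma sigma_sigma_iter k x : sigma (s k x) = s k.+1 x.
Proof. by rewrite -sigma_iter_1 sigma_iter_add. Qed.

Lemma sigma_iter_mod k x : s (k + 5) x = s k x.
Proof. by rewrite -sigma_iter_add [s 5 x](sigma_pow5 D). Qed.

(** From c sigma = sigma^-1 c, the composite sigma^k c sigma^k equals c. *)
Lemma sigma_iter_c k x : (k <= 5)%N -> c (s k x) = s (5 - k) (c x).
Proof.
move=> k5.
have e : s k (c (s k x)) = c x.
  elim: k {k5} => [|k IH]; first by rewrite !sigma_iter_0.
  rewrite -(addn1 k) -(sigma_iter_add k 1 (c _)) addnC -(sigma_iter_add 1 k x).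
  rewrite sigma_iter_1 sigma_iter_1 (c_sigma_conj D) -galM ?memvf // mulVg gal_id.
  exact: IH.
by rewrite -e sigma_iter_add subnK // -[5%N]add0n sigma_iter_mod sigma_iter_0.
Qed.

Lemma c_id x : x \in K -> c x = x. Proof. by move/(c_fixed D). Qed.

Lemma absv_sym k x : (k <= 5)%N -> x \in K -> absv (5 - k) x = absv k x.
Proof.
by move=> k5 xK; rewrite /absv -[in LHS](c_id xK) -sigma_iter_c // (J_c D) normc_conj.
Qed.

Lemma absv_sigma_iter j k x : absv j (s k x) = absv (j + k) x.
Proof. by rewrite /absv sigma_iter_add. Qed.

Lemma absv_mod k x : absv (k + 5) x = absv k x.
Proof. by rewrite /absv sigma_iter_mod. Qed.

Lemma absvM k x y : absv k (x * y) = absv k x * absv k y.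
Proof. by rewrite /absv /sigma_iter !rmorphM Normc.normcM. Qed.

Lemma absv_eq0 k x : (absv k x == 0) = (x == 0).
Proof. by rewrite normc_eq0 !fmorph_eq0. Qed.

Lemma absv_int k (n : int) : absv k n%:~R = `|n%:~R|.
Proof. by rewrite /absv /sigma_iter !rmorph_int normc_int. Qed.

Lemma absvV k x : absv k x^-1 = (absv k x)^-1.
Proof. by rewrite /absv /sigma_iter !fmorphV Normc.normcV. Qed.

Lemma absv_sum k (I : Type) (r : seq I) (x : I -> L) :
  absv k (\sum_(i <- r) x i) <= \sum_(i <- r) absv k (x i).
Proof. by rewrite /absv /sigma_iter !rmorph_sum; apply: normc_sum. Qed.

Lemma absv0_iota (x : subvs_of K) : absv 0 (vsval x) = `|iota x|.
Proof. by rewrite /absv sigma_iter_0 (J_iota D) normc_real. Qed.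

Definition trace5 x : L := x + s 1 x + s 2 x + s 3 x + s 4 x.
(** The product of the other four conjugates, so that norm5 x / x stays
integral. *)
Definition conorm5 x : L := s 1 x * s 2 x * s 3 x * s 4 x.

(** The norm of x from K to Q, for x in K; likewise trace5 is the trace. *)
Definition norm5 x : L := x * conorm5 x.

Let c_s x : x \in K ->
  [/\ c (s 1 x) = s 4 x, c (s 2 x) = s 3 x, c (s 3 x) = s 2 x & c (s 4 x) = s 1 x].
Proof. by move=> xK; split; rewrite sigma_iter_c // (c_id xK). Qed.

(** The sum of conjugates is permuted cyclically by sigma and reflected by c. *)
Lemma trace5_rational x : x \in K -> trace5 x \in 1%VS.
Proof.
move=> xK; have [e1 e2 e3 e4] := c_s xK; apply: (fixed_rational D).
  rewrite /trace5 !rmorphD /= !sigma_sigma_iter -sigma_iter_1.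
  by rewrite (sigma_iter_mod 0) sigma_iter_0; ring.
by rewrite /trace5 !rmorphD /= e1 e2 e3 e4 c_id //; ring.
Qed.

Lemma conorm5_in x : x \in K -> conorm5 x \in K.
Proof.
move=> xK; have [e1 e2 e3 e4] := c_s xK; apply/(c_fixed D).
by rewrite /conorm5 !rmorphM /= e1 e2 e3 e4; ring.
Qed.

Lemma norm5_rational x : x \in K -> norm5 x \in 1%VS.
Proof.
move=> xK; apply: (fixed_rational D); last first.
  by apply: c_id; rewrite memvM ?conorm5_in.
rewrite /norm5 /conorm5 !rmorphM /= !sigma_sigma_iter -sigma_iter_1.
by rewrite (sigma_iter_mod 0) sigma_iter_0; ring.
Qed.

Lemma algint_sigma_iter k x : algint x -> algint (s k x).
Proof. exact: (algint_rmorph (_ : {rmorphism L -> L})). Qed.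

Lemma trace5_int x : x \in K -> algint x -> exists n : int, trace5 x = n%:~R.
Proof.
move=> xK ix; apply: rational_algint; first exact: trace5_rational.
by rewrite /trace5; do !apply: algintD => //; apply: algint_sigma_iter.
Qed.

Lemma algint_conorm5 x : algint x -> algint (conorm5 x).
Proof.
by move=> ix; rewrite /conorm5; do !apply: algintM => //; apply: algint_sigma_iter.
Qed.

Lemma norm5_int x : x \in K -> algint x -> exists n : int, norm5 x = n%:~R.
Proof.
move=> xK ix; apply: rational_algint; first exact: norm5_rational.
by apply: algintM => //; apply: algint_conorm5.
Qed.

Lemma absv_norm5 x : x \in K ->
  absv 0 (norm5 x) = absv 0 x * absv 1 x ^+ 2 * absv 2 x ^+ 2.
Proof.
move=> xK; rewrite /norm5 /conorm5 !absvM !absv_sigma_iter !add0n.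
by rewrite -(@absv_sym 3) // -(@absv_sym 4) // !subSS !subn0; ring.
Qed.

Lemma norm5_neq0 x : x != 0 -> norm5 x != 0.
Proof. by move=> x0; rewrite /norm5 /conorm5 !mulf_eq0 !fmorph_eq0 (negPf x0). Qed.

(** The norm of x is a nonzero rational integer. *)
Lemma absv_norm5_ge1 x : x \in K -> algint x -> x != 0 ->
  1 <= absv 0 x * absv 1 x ^+ 2 * absv 2 x ^+ 2.
Proof.
move=> xK ix x0; rewrite -absv_norm5 //.
have [n e] := norm5_int xK ix; have := norm5_neq0 x0.
rewrite e absv_int num_field_intr_eq0 -intr_norm => n0.
by rewrite ler1z -gtz0_ge1 normr_gt0.
Qed.

(** * Algebraic integers with bounded conjugates *)

Lemma trace5Z (a : rat) x : trace5 (a *: x) = a *: trace5 x.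
Proof. by rewrite /trace5 /sigma_iter !linearZ /= !scalerDr. Qed.

Lemma trace5_sum (I : Type) (r : seq I) (x : I -> L) :
  trace5 (\sum_(i <- r) x i) = \sum_(i <- r) trace5 (x i).
Proof. by rewrite /trace5 /sigma_iter !rmorph_sum -!big_split. Qed.

Lemma trace5B x y : trace5 (x - y) = trace5 x - trace5 y.
Proof. by rewrite /trace5 /sigma_iter !rmorphB; ring. Qed.

Lemma absv_trace5 x : absv 0 (trace5 x) <= \sum_(k < 5) absv k x.
Proof.
rewrite /absv /trace5 sigma_iter_0 !rmorphD /=.
rewrite !big_ord_recr big_ord0 /= add0r sigma_iter_0.
by do 4!(apply: le_trans (le_normcD _ _) _; rewrite lerD2r).
Qed.

(** If y is not 0 then y^-1 is a combination of the e i, and y y^-1 = 1 has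
trace 5. *)
Lemma trace5_nondegenerate n (e : 'I_n -> L) y : integral_basis K e -> y \in K ->
  (forall i, trace5 (y * e i) = 0) -> y = 0.
Proof.
move=> be yK ye; apply: contrapT => /eqP y0.
have yV : y^-1 \in K by rewrite memvV.
have [q qE] := ibasis_span be yV.
have : trace5 (y * y^-1) = 0.
  rewrite qE mulr_sumr trace5_sum big1 // => i _.
  by rewrite -scalerAr trace5Z ye scaler0.
rewrite divff // /trace5 /sigma_iter !rmorph1 => /eqP.
have -> : 1 + 1 + 1 + 1 + 1 = (5 : int)%:~R :> L by ring.
by rewrite num_field_intr_eq0.
Qed.

(** The traces of the products of y with an integral basis determine y. They are
integers, bounded in terms of the conjugates of y, so there are finitely many
possible y. The conclusion is phrased as a pigeonhole principle, with a bound
that is uniform in f. *)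
Lemma bounded_algint_finite (B : R) : exists n, forall f : nat -> L,
  (forall i, [/\ f i \in K, algint (f i) & forall k, (k < 5)%N -> absv k (f i) <= B]) ->
  exists i j, [/\ (i < j)%N, (j <= n)%N & f i = f j].
Proof.
have [e be] := integral_basis_exists K; set d := \dim K in e be.
pose X := \sum_(j < d) \sum_(k < 5) `|B| * absv k (e j).
pose M := (Num.truncn X).+1.
exists #|{ffun 'I_d -> 'I_(M + M).+1}| => f hf.
have /choice[t tE] i : exists t : 'I_d -> int, forall j, trace5 (f i * e j) = (t j)%:~R.
  have [fK fi _] := hf i.
  have /choice[t h] (j : 'I_d) : exists n : int, trace5 (f i * e j) = n%:~R.
    apply: trace5_int; first by rewrite memvM // (ibasis_mem be).
    by apply: algintM => //; apply: (ibasis_int be).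
  by exists t.
have tM i j : `|t i j| <= M%:Z.
  have [fK fi fB] := hf i.
  rewrite -(ler_int R) intr_norm -(absv_int 0) -tE.
  apply: le_trans (absv_trace5 _) _.
  have XM : X <= M%:R by exact/ltW/truncnS_gt.
  apply: le_trans XM; rewrite /X (bigD1 j) //= ler_wpDr //.
    by do 2!apply: sumr_ge0 => ? _; rewrite mulr_ge0 // normc_ge0.
  apply: ler_sum => k _; rewrite absvM ler_wpM2r ?normc_ge0 //.
  by apply: le_trans (fB _ _) (ler_norm _).
(* The shift by M makes the traces natural numbers, to index a finite type. *)
pose g i : {ffun 'I_d -> 'I_(M + M).+1} := [ffun j => inord `|(t i j + M%:Z)%R|%N].
have [i [j [ij jn gij]]] := pigeonhole_nat g.
exists i, j; split=> //.
have tt l : t i l = t j l.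
  have := congr1 (fun h : {ffun 'I_d -> 'I_(M + M).+1} => val (h l)) gij.
  have := tM i l; have := tM j l; rewrite !ler_norml /= !ffunE.
  move: (t i l) (t j l) (M) => a b m /andP[? ?] /andP[? ?].
  by rewrite !inordK; lia.
apply/eqP; rewrite -subr_eq0; apply/eqP.
have [[iK _ _] [jK _ _]] := (hf i, hf j).
apply: trace5_nondegenerate be _ _; first by rewrite memvB.
by move=> l; rewrite mulrBl trace5B !tE tt subrr.
Qed.

(** * Existence of a unit with two expanding conjugates *)

Section UnitExistence.
Hypothesis dimK : \dim K = 5%N.

Variable e : 'I_(\dim K) -> L.
Hypothesis be : integral_basis K e.

Definition zcomb (z : 'I_(\dim K) -> int) : L := \sum_j e j *~ z j.

Lemma zcomb_in z : zcomb z \in K.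
Proof. by apply: rpred_sum => j _; rewrite rpredMz // (ibasis_mem be). Qed.

Lemma zcomb_int z : algint (zcomb z).
Proof.
apply: algint_sum => j _; rewrite -mulrzl; apply: algintM; first exact: algint_int.
exact: ibasis_int be j.
Qed.

Lemma zcombB z z' : zcomb z - zcomb z' = zcomb (fun j => z j - z' j).
Proof. by rewrite /zcomb -sumrB; apply: eq_bigr => j _; rewrite mulrzBr. Qed.

Lemma zcomb_eq0 z : zcomb z = 0 -> forall j, z j = 0.
Proof.
move=> h j; have /(ibasis_free be)/(_ j) : \sum_j (z j)%:~R *: e j = 0.
  by rewrite -[RHS]h; apply: eq_bigr => k _; rewrite scaler_int.
by move/eqP; rewrite intr_eq0 => /eqP.
Qed.

(** The summand 1 makes the bound at least 1 whatever the basis. *)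
Definition size_bound : R := 1 + \sum_(k < 5) \sum_j absv k (e j).
Local Notation S := size_bound.

Lemma size_bound_ge1 : 1 <= S.
Proof. by rewrite lerDl; do 2!apply: sumr_ge0 => ? _; apply: normc_ge0. Qed.

Lemma absv_zcomb k z (Q : nat) : (k < 5)%N -> (forall j, `|z j| <= Q%:Z) ->
  absv k (zcomb z) <= S * Q%:R.
Proof.
move=> k5 zQ; apply: le_trans (absv_sum _ _ _) _.
apply: le_trans (_ : (\sum_j absv k (e j)) * Q%:R <= _).
  rewrite mulr_suml; apply: ler_sum => j _.
  rewrite -mulrzl absvM absv_int mulrC ler_wpM2l ?normc_ge0 //.
  by rewrite -intr_norm -[Q%:R]/(Q%:Z%:~R) ler_int.
rewrite ler_wpM2r ?ler0n // /size_bound (bigD1 (Ordinal k5)) //=.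
have : 0 <= \sum_(i < 5 | i != Ordinal k5) \sum_j absv i (e j).
  by do 2!apply: sumr_ge0 => ? _; apply: normc_ge0.
by move=> h; rewrite addrCA lerDl addr_ge0.
Qed.

(** The (Q + 1)^5 combinations with coefficients in 0..Q have real images in an
interval of length 2 S Q, and they outnumber the Q^5 + 1 boxes, so two of them
differ by at most 2 S / Q^4 at the real place. *)
Lemma small_zcomb (Q : nat) : (0 < Q)%N -> exists z,
  [/\ zcomb z != 0, absv 0 (zcomb z) * Q%:R ^+ 4 <= 2 * S &
      forall k, (k < 5)%N -> absv k (zcomb z) <= S * Q%:R].
Proof.
move=> Q0; have S1 := size_bound_ge1.
have QR : (0 : R) < Q%:R by rewrite ltr0n.
pose T := {ffun 'I_(\dim K) -> 'I_Q.+1}.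
pose x (t : T) := zcomb (fun j => (t j : nat)%:Z).
have xK t : x t \in K by exact: zcomb_in.
pose v t := iota (Subvs (xK t)).
have vE t t' : `|v t - v t'| = absv 0 (x t - x t').
  by rewrite -rmorphB -absv0_iota.
have vB t : `|v t| <= S * Q%:R.
  rewrite -absv0_iota; apply: absv_zcomb => // j.
  by have := ltn_ord (t j); lia.
have [||||t [t' [tt' h]]] := @real_pigeonhole _ _ v (S * Q%:R) (Q ^ 5).
- by rewrite mulr_gt0 // (lt_le_trans ltr01).
- by rewrite expn_gt0 Q0.
- rewrite card_ffun !card_ord dimK.
  (* Q^5 + 1 < (Q + 1)^5, as Q > 0. *)
  have -> : (Q.+1 ^ 5 = Q ^ 5 + (5 * Q ^ 4 + 10 * Q ^ 3 + 10 * Q ^ 2 + 5 * Q + 1))%N.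
    by rewrite -addn1; ring.
  by lia.
- exact: vB.
have e1 : x t - x t' = zcomb (fun j => (t j : nat)%:Z - (t' j : nat)%:Z) by apply: zcombB.
exists (fun j => (t j : nat)%:Z - (t' j : nat)%:Z); rewrite -e1; split.
- apply/eqP => h0; case/eqP: tt'; apply/ffunP => j; apply: val_inj.
  by move: h0; rewrite e1 => /zcomb_eq0/(_ j)/=; lia.
- move: h; rewrite vE natrX [_ ^+ 5]exprSr !mulrA ler_pM2r //.
- move=> k k5; rewrite e1; apply: absv_zcomb => // j.
  by have := ltn_ord (t j); have := ltn_ord (t' j); lia.
Qed.

(** If y = x modulo W and the norm of x divides W, then y / x = 1 + t W / x is
integral, because norm5 x / x is. *)
Lemma algint_norm_quotient (W : nat) x y t : x \in K -> algint x -> x != 0 ->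
  (exists n : int, norm5 x = n%:~R /\ (n %| W%:Z)%Z) ->
  algint t -> y - x = t * W%:R -> algint (y / x).
Proof.
move=> xK ix x0 [n [xn /dvdzP[q Wq]]] it yx.
have -> : y / x = 1 + t * (q%:~R * conorm5 x).
  have -> : y = x + t * W%:R by rewrite -yx addrC subrK.
  rewrite -[W%:R]/(W%:Z%:~R) Wq rmorphM /= -xn /norm5; field.
  exact: x0.
apply: algintD; first exact: integral1.
apply: algintM => //; apply: algintM; [exact: algint_int|exact: algint_conorm5].
Qed.

(** Take the x n of small_zcomb with Q = b.+1 ^ n. Their norms are at most B =
2S^5, so all of them divide W = b!, and two of them, x n and x m, have the same
coordinates modulo W. Their quotient is a unit. At the complex places |x n|^2
lies between Q^2 / (2 S^3) and S^2 Q^2, so the ratio b.+1 > 2S^5 between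
consecutive values of Q makes x m larger than x n there when n < m. *)
Lemma expanding_unit_exists : exists u,
  [/\ u \in K, algint u, algint u^-1, 1 < absv 1 u & 1 < absv 2 u].
Proof.
have S1 := size_bound_ge1; have S0 : 0 < S by exact: lt_le_trans S1.
pose B := 2 * S ^+ 5; pose b := Num.truncn B.
have B0 : 0 <= B by rewrite mulr_ge0 // exprn_ge0 // ltW.
have Bb : B < b.+1%:R by exact: truncnS_gt.
have /choice[z zP] n := small_zcomb (expn_gt0 b.+1 n : (0 < b.+1 ^ n)%N).
pose x n := zcomb (z n); pose Q n : R := (b.+1 ^ n)%:R.
have Q0 n : 0 < Q n by rewrite ltr0n expn_gt0.
have xK n : x n \in K by exact: zcomb_in.
have xi n : algint (x n) by exact: zcomb_int.
have x0 n : x n != 0 by have [] := zP n.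
have ge1 n := absv_norm5_ge1 (xK n) (xi n) (x0 n).
have up k n : (k < 5)%N -> absv k (x n) ^+ 2 <= S ^+ 2 * Q n ^+ 2.
  move=> k5; rewrite -exprMn lerXn2r ?nnegrE ?normc_ge0 //.
    by rewrite mulr_ge0 // ltW.
  by have [_ _ ->] := zP n.
have small n : absv 0 (x n) * Q n ^+ 4 <= 2 * S by have [] := zP n.
have low1 n : Q n ^+ 2 <= 2 * S ^+ 3 * absv 1 (x n) ^+ 2.
  by apply: middle_factor_ge (ge1 n) (small n) (up 2 n _); rewrite ?sqr_ge0 ?normc_ge0.
have low2 n : Q n ^+ 2 <= 2 * S ^+ 3 * absv 2 (x n) ^+ 2.
  have := ge1 n; rewrite mulrAC => h.
  by apply: middle_factor_ge h (small n) (up 1 n _); rewrite ?sqr_ge0 ?normc_ge0.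
have normB n : absv 0 (norm5 (x n)) <= B.
  rewrite (absv_norm5 (xK n)).
  have -> : B = 2 * S * (S ^+ 2 * S ^+ 2) by rewrite /B; ring.
  have Q4 : 0 < Q n ^+ 4 by rewrite exprn_gt0.
  rewrite -(ler_pM2r Q4).
  have -> : absv 0 (x n) * absv 1 (x n) ^+ 2 * absv 2 (x n) ^+ 2 * Q n ^+ 4
    = absv 0 (x n) * Q n ^+ 4 * (absv 1 (x n) ^+ 2 * absv 2 (x n) ^+ 2) by ring.
  have -> : 2 * S * (S ^+ 2 * S ^+ 2) * Q n ^+ 4
    = 2 * S * ((S ^+ 2 * Q n ^+ 2) * (S ^+ 2 * Q n ^+ 2)) by ring.
  apply: ler_pM => //.
  - by rewrite mulr_ge0 ?normc_ge0 // ltW.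
  - by rewrite mulr_ge0 ?sqr_ge0.
  by apply: ler_pM; rewrite ?sqr_ge0 ?up.
pose W := b`!.
have normW n : exists m : int, norm5 (x n) = m%:~R /\ (m %| W%:Z)%Z.
  have [m em] := norm5_int (xK n) (xi n); exists m; split=> //.
  rewrite dvdzE /= dvdn_fact // absz_gt0; apply/andP; split.
    by rewrite -(num_field_intr_eq0 L) -em (norm5_neq0 (x0 n)).
  rewrite truncn_ge_nat //; have := normB n; rewrite em absv_int.
  by rewrite -intr_norm -abszE.
have W0 : (0 < W)%N by rewrite fact_gt0.
pose g n : {ffun 'I_(\dim K) -> 'I_W.+1} := [ffun j => inord `|(z n j %% W)%Z|].
have [n [m [nm _ gnm]]] := pigeonhole_nat g.
have /choice[t tE] j : exists t : int, z m j - z n j = t * W%:Z.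
  have := congr1 (fun h : {ffun 'I_(\dim K) -> 'I_W.+1} => val (h j)) gnm.
  have h k : (`|(z k j %% W)%Z| < W.+1)%N /\ (0 <= (z k j %% W)%Z).
    have := @ltz_pmod (z k j) W; have := @modz_ge0 (z k j) W; lia.
  have [hn1 hn2] := h n; have [hm1 hm2] := h m.
  rewrite /= !ffunE !inordK // => e1.
  exists ((z m j %/ W)%Z - (z n j %/ W)%Z).
  rewrite [in LHS](divz_eq (z m j) W) [in LHS](divz_eq (z n j) W).
  lia.
have diff : x m - x n = zcomb t * W%:R.
  rewrite zcombB /zcomb mulr_suml; apply: eq_bigr => j _.
  by rewrite tE mulrzA pmulrn mulrzr.
have diff' : x n - x m = - zcomb t * W%:R by rewrite mulNr -diff opprB.
have it : algint (zcomb t) by exact: zcomb_int.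
have grow k : (0 < k < 3)%N -> 1 < absv k (x m / x n).
  move=> k3; have pos : 0 < absv k (x n) by rewrite lt_def absv_eq0 x0 normc_ge0.
  rewrite absvM absvV ltr_pdivlMr // mul1r.
  rewrite -(@ltr_pXn2r _ 2) ?nnegrE ?normc_ge0 //.
  have lo : Q m ^+ 2 <= 2 * S ^+ 3 * absv k (x m) ^+ 2.
    by case: k k3 {pos} => [|[|[|]]].
  have hi : absv k (x n) ^+ 2 <= S ^+ 2 * Q n ^+ 2.
    by apply: up; case/andP: k3 => _ /ltn_trans->.
  have QQ : Q n * b.+1%:R <= Q m.
    by rewrite -natrM ler_nat -expnSr leq_pexp2l.
  have S3 : 0 < 2 * S ^+ 3 by rewrite mulr_gt0 // exprn_gt0.
  rewrite -(ltr_pM2l S3); apply: lt_le_trans lo.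
  apply: le_lt_trans (_ : B * Q n ^+ 2 < _).
    have -> : B * Q n ^+ 2 = 2 * S ^+ 3 * (S ^+ 2 * Q n ^+ 2) by rewrite /B; ring.
    by rewrite ler_pM2l.
  apply: lt_le_trans (_ : b.+1%:R * Q n ^+ 2 <= _).
    by rewrite ltr_pM2r // exprn_gt0.
  apply: le_trans (_ : (Q n * b.+1%:R) ^+ 2 <= _).
    have b1 : (1 : R) <= b.+1%:R by rewrite ler1n.
    by rewrite exprMn mulrC ler_pM2l ?exprn_gt0 // expr2 ler_peMr // ler0n.
  by rewrite lerXn2r ?nnegrE ?mulr_ge0 ?ler0n ?(ltW (Q0 _)).
exists (x m / x n); split.
- by rewrite memvM ?memvV.
- exact: algint_norm_quotient (normW n) it diff.
- rewrite invf_div; apply: algint_norm_quotient (normW m) _ diff' => //.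
  by rewrite -sub0r; apply: algintB => //; exact: integral0.
- exact: grow.
- exact: grow.
Qed.

End UnitExistence.

(** * The logarithms of the units *)

Local Notation E := (Egroup (subvs_of K)).

Definition conj_emb k : {rmorphism subvs_of K -> R[i]} :=
  J \o (sigma ^+ k)%g \o (vsval : {rmorphism subvs_of K -> L}).

Local Notation ell k := (log_complex (conj_emb k)).

Lemma ell_pi k (u : Ounits (subvs_of K)) :
  ell k (\pi_E u) = ln (absv k (vsval (\val u))).
Proof. by rewrite log_complex_pi. Qed.

Lemma log_real_ell u : log_real iota u = ell 0 u.
Proof. by rewrite /log_real -absv0_iota. Qed.

Lemma algint_Ounit (u : Ounits (subvs_of K)) :
  algint (vsval (\val u)) /\ algint (vsval (\val u))^-1.
Proof.
have /asboolP[iu _] := valP u; have /asboolP[iV _] := OunitV (valP u).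
split; first exact: (algint_rmorph (vsval : {rmorphism subvs_of K -> L}) iu).
rewrite -(fmorphV (vsval : {rmorphism subvs_of K -> L})).
exact: (algint_rmorph (vsval : {rmorphism subvs_of K -> L}) iV).
Qed.

Lemma Ounit_subvs (x : L) (xK : x \in K) : algint x -> algint x^-1 -> x != 0 ->
  Ounit (Subvs xK).
Proof.
move=> ix iV x0; apply/asboolP; split; first exact: algint_subvs.
exists (Subvs xK)^-1.
  apply: algint_subvs; rewrite (fmorphV (vsval : {rmorphism subvs_of K -> L})).
  exact: iV.
by rewrite divff // -(fmorph_eq0 (vsval : {rmorphism subvs_of K -> L})).
Qed.

Lemma elt_neq0 (u : Ounits (subvs_of K)) : vsval (\val u) != 0.
Proof.
by rewrite (fmorph_eq0 (vsval : {rmorphism subvs_of K -> L})) (Ounit_neq0 (valP u)).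
Qed.

Lemma absv_gt0 k x : x != 0 -> 0 < absv k x.
Proof. by move=> x0; rewrite lt_def absv_eq0 x0 normc_ge0. Qed.

(** The product of the conjugates of u is at least 1 in absolute value, and so
is that of u^-1. *)
Lemma ell_norm u : ell 0 u + 2 * ell 1 u + 2 * ell 2 u = 0.
Proof.
rewrite -[u]reprK !ell_pi; set x := vsval _.
have xK : x \in K := valP (\val (repr u)).
have [ix iV] := algint_Ounit (repr u); have x0 := elt_neq0 (repr u).
rewrite -/x in ix iV x0.
have h1 := absv_norm5_ge1 xK ix x0.
have h2 : 1 <= absv 0 x^-1 * absv 1 x^-1 ^+ 2 * absv 2 x^-1 ^+ 2.
  by apply: absv_norm5_ge1; rewrite ?memvV ?invr_eq0.
have p0 := absv_gt0 0 x0; have p1 := absv_gt0 1 x0; have p2 := absv_gt0 2 x0.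
have : absv 0 x * absv 1 x ^+ 2 * absv 2 x ^+ 2 = 1.
  apply/eqP; rewrite eq_le h1 andbT.
  by move: h2; rewrite !absvV !exprVn -!invfM invf_ge1 // !mulr_gt0 ?exprn_gt0.
move/(congr1 (@ln R)); rewrite ln1 !lnM ?posrE ?mulr_gt0 ?exprn_gt0 // => h.
by rewrite -[RHS]h; ring.
Qed.

Lemma sigmaVE x : (sigma^-1)%g x = s 4 x.
Proof.
rewrite -[in LHS](sigma_iter_0 x) -(sigma_iter_mod 0) -(sigma_iter_add 1 4).
by rewrite sigma_iter_1 -galM ?memvf // mulgV gal_id.
Qed.

Lemma gal_trace_in x : x \in K -> sigma x * (sigma^-1)%g x \in K.
Proof.
move=> xK; apply/(c_fixed D).
rewrite sigmaVE -sigma_iter_1 rmorphM /= !sigma_iter_c // (c_id xK) !subSS !subn0.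
by rewrite mulrC.
Qed.

Fact gal_trace_Ounit (u : Ounits (subvs_of K)) :
  Ounit (Subvs (gal_trace_in (valP (\val u)))).
Proof.
have aut (g : gal_of {:L}) y : algint y -> algint (g y).
  exact: (algint_rmorph (_ : {rmorphism L -> L})).
have autV (g : gal_of {:L}) y : algint y^-1 -> algint (g y)^-1.
  by rewrite -fmorphV; apply: aut.
have [iu iV] := algint_Ounit u; apply: Ounit_subvs.
- by apply: algintM; apply: aut.
- by rewrite invfM; apply: algintM; apply: autV.
- by rewrite mulf_eq0 !fmorph_eq0 orbb elt_neq0.
Qed.

Definition gal_trace_unit (u : Ounits (subvs_of K)) := MkOunits (gal_trace_Ounit u).

(** The trace is defined on a representative; gal_traceP shows that this choice
does not matter, and makes gal_trace additive. *)
Definition gal_trace (u : E) : E := \pi_E (gal_trace_unit (repr u)).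

Lemma gal_traceP u : is_gal_trace sigma u (gal_trace u).
Proof.
rewrite /is_gal_trace -[u in RHS]reprK /E_incl /E_gal !E_map_pi -raddfD.
by rewrite reprK; congr (\pi_(_) _); apply: val_inj.
Qed.

Lemma gal_trace_unique u v : is_gal_trace sigma u v -> v = gal_trace u.
Proof. by move=> h; apply: E_incl_inj; rewrite h gal_traceP. Qed.

Fact gal_trace_zmod : zmod_morphism gal_trace.
Proof.
move=> u v; apply/esym/gal_trace_unique; rewrite /is_gal_trace.
have := gal_traceP v; have := gal_traceP u.
rewrite /is_gal_trace /E_incl /E_gal !E_map_zmod => -> ->.
by rewrite opprD addrACA.
Qed.

HB.instance Definition _ := GRing.isZmodMorphism.Build E E gal_trace gal_trace_zmod.

Lemma ell_gal_trace k u : ell k (gal_trace u) = ell k.+1 u + ell (k + 4) u.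
Proof.
rewrite -{2 3}[u]reprK !ell_pi /= sigmaVE absvM -sigma_iter_1 !absv_sigma_iter addn1.
by rewrite lnM // posrE absv_gt0 // elt_neq0.
Qed.

Lemma ell_mod k u : ell (k + 5) u = ell k u.
Proof. by rewrite -[u]reprK !ell_pi absv_mod. Qed.

Lemma ell_sym k u : (k <= 5)%N -> ell (5 - k) u = ell k u.
Proof. by move=> k5; rewrite -[u]reprK !ell_pi absv_sym //; apply: valP. Qed.

Lemma ell0_gal_trace u : ell 0 (gal_trace u) = 2 * ell 1 u.
Proof. by rewrite ell_gal_trace (@ell_sym 1) //; ring. Qed.

Lemma ell1_gal_trace u : ell 1 (gal_trace u) = ell 0 u + ell 2 u.
Proof. by rewrite ell_gal_trace (ell_mod 0) addrC. Qed.

Lemma ell2_gal_trace u : ell 2 (gal_trace u) = ell 1 u + ell 2 u.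
Proof. by rewrite ell_gal_trace (ell_mod 1) (@ell_sym 2) // addrC. Qed.

(** An upper bound on three logarithms bounds all five conjugates, as the others
are complex conjugate to these. *)
Lemma bounded_units_finite (B : R) : exists n, forall f : nat -> Ounits (subvs_of K),
  (forall i k, (k < 3)%N -> ln (absv k (vsval (\val (f i)))) <= B) ->
  exists i j, [/\ (i < j)%N, (j <= n)%N & f i = f j].
Proof.
have [n hn] := bounded_algint_finite (expR B); exists n => f hf.
have [i|i [j [ij jn e]]] := hn (fun i => vsval (\val (f i))); last first.
  by exists i, j; split=> //; do 2!apply: val_inj.
split; [exact: valP|by have [] := algint_Ounit (f i)|].
have h k : (k < 3)%N -> absv k (vsval (\val (f i))) <= expR B.
  move=> k3; rewrite -[X in X <= _]lnK ?posrE ?absv_gt0 ?elt_neq0 //.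
  by rewrite ler_expR hf.
move=> k k5; case: (ltnP k 3) => [/h //|k3].
by rewrite -(absv_sym (ltnW k5)) ?h ?(valP (\val (f i))) //; lia.
Qed.

(** Kronecker: if all conjugates of u have absolute value 1, its powers stay in
a finite set, so u is torsion. *)
Lemma ell_inj u : (forall k, (k < 3)%N -> ell k u = 0) -> u = 0.
Proof.
move=> h; have [n hn] := bounded_units_finite 0.
have [i k k3|i [j [ij _ e]]] := hn (fun i => repr u *+ i).
  by rewrite -ell_pi raddfMn /= reprK raddfMn /= h // mul0rn.
rewrite -[u]reprK -[0](raddf0 (\pi_E)); apply/eqP/eq_piE; exists (j - i)%N.
  by rewrite subn_gt0.
by rewrite subr0 mulrnBr ?(ltnW ij) // e subrr.
Qed.

(** It suffices to compare logarithms, by ell_inj; there it follows from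
ell_norm. *)
Lemma gal_trace_quad u : gal_trace (gal_trace u) = u - gal_trace u.
Proof.
apply/eqP; rewrite -subr_eq0; apply/eqP/ell_inj => k k3.
have := ell_norm u; rewrite !raddfB /=.
case: k k3 => [|[|[|//]]] _;
  rewrite !(ell0_gal_trace, ell1_gal_trace, ell2_gal_trace); lra.
Qed.

Lemma units_box_finite (B : R) : exists n, forall f : nat -> E,
  (forall i, `|ell 0 (f i)| <= B /\ `|ell 0 (gal_trace (f i))| <= B) ->
  exists i j, [/\ (i < j)%N, (j <= n)%N & f i = f j].
Proof.
have [n hn] := bounded_units_finite B; exists n => f hf.
have [i k k3|i [j [ij jn e]]] := hn (fun i => repr (f i)); last first.
  by exists i, j; split=> //; rewrite -[f i]reprK -[f j]reprK e.
rewrite -ell_pi reprK; have [] := hf i; rewrite ell0_gal_trace.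
have := ell_norm (f i); rewrite !ler_norml => h0 /andP[? ?] /andP[? ?].
by case: k k3 => [|[|[|//]]] _; lra.
Qed.

(** With l_k the logarithms of the unit of expanding_unit_exists, ell_norm gives
l_0 = -2 l_1 - 2 l_2, whence N5 l_0 (2 l_1) = l_0^2 + 4 l_1 l_2 > 0. *)
Lemma Zbasis_of_units : \dim K = 5%N -> exists u0 : E, is_Zbasis [tuple u0; gal_trace u0].
Proof.
move=> dimK; have [e be] := integral_basis_exists K.
have [x [xK ix iV x1 x2]] := expanding_unit_exists dimK be.
have x0 : x != 0.
  apply: contraTneq x1 => ->; rewrite (_ : absv 1 0 = 0) ?ltr10 //.
  by apply/eqP; rewrite absv_eq0.
pose v := \pi_E (MkOunits (Ounit_subvs xK ix iV x0)).
have inj u : ell 0 u = 0 -> ell 0 (gal_trace u) = 0 -> u = 0.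
  rewrite ell0_gal_trace => h0 h1; apply: ell_inj; have := ell_norm u.
  by move=> h2 [|[|[|//]]] _; lra.
apply: (@Zbasis_of_norm_euclidean _ _ gal_trace (ell 0) gal_trace_quad inj
  units_box_finite v).
have l1 : 0 < ell 1 v by rewrite ell_pi ln_gt0.
have l2 : 0 < ell 2 v by rewrite ell_pi ln_gt0.
have h := ell_norm v.
have -> : ell_form gal_trace (ell 0) v = N5 (ell 0 v) (2 * ell 1 v).
  by rewrite -ell0_gal_trace.
rewrite /N5.
have -> : ell 0 v = - 2 * ell 1 v - 2 * ell 2 v by lra.
by apply: lt0r_neq0; nra.
Qed.

(** * The regulator *)

Lemma conj_emb_real x : complex.Im (conj_emb 0 x) = 0.
Proof. by rewrite /= gal_id (J_iota D). Qed.

Lemma conj_emb_conj k : (k <= 5)%N -> conj_embeddings (conj_emb k) (conj_emb (5 - k)).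
Proof.
move=> k5 x; have xK : vsval x \in K := valP x.
rewrite -[LHS]/(J (sigma_iter (5 - k) (vsval x))) -[in LHS](c_id xK).
by rewrite -sigma_iter_c // (J_c D).
Qed.

Lemma conj_emb_nonreal k : ~~ (5 %| k)%N -> nonreal_embedding (conj_emb k).
Proof. by move=> k5; have [x ?] := sigma_nonreal D k5; exists x. Qed.

(** Cancelling sigma^k, two equal embeddings would make sigma^j the identity on
K, where J is real. *)
Lemma conj_emb_neq j k : ~~ (5 %| j)%N -> ~ conj_emb k =1 conj_emb (k + j).
Proof.
move=> j5 h; have [x /eqP[]] := sigma_nonreal D j5.
have e : vsval x = (sigma ^+ j)%g (vsval x).
  apply: (fmorph_inj ((sigma ^+ k)%g : {rmorphism L -> L})).
  by apply: (fmorph_inj J); rewrite [RHS](congr1 J (sigma_iter_add k j _)); apply: h.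
by rewrite -e (J_iota D).
Qed.

Lemma log_complex_eq (tau rho : {rmorphism subvs_of K -> R[i]}) u :
  tau =1 rho -> log_complex tau u = log_complex rho u.
Proof. by move=> e; rewrite /log_complex e. Qed.

Lemma log_complex_conj (tau rho : {rmorphism subvs_of K -> R[i]}) u :
  conj_embeddings tau rho -> log_complex rho u = log_complex tau u.
Proof. by move=> e; rewrite /log_complex e normc_conj. Qed.

Definition conj_class k (rho : {rmorphism subvs_of K -> R[i]}) :=
  rho =1 conj_emb k \/ conj_embeddings (conj_emb k) rho.

Lemma nonreal_conj_class (rho : {rmorphism subvs_of K -> R[i]}) :
  nonreal_embedding rho -> conj_class 1 rho \/ conj_class 2 rho.
Proof.
move=> [x nr]; have [k k5 e] := embeddings_K D rho.
have {}e : rho =1 conj_emb k by exact: e.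
case: k k5 e => [|[|[|[|[|//]]]]] _ e.
- by move: nr; rewrite e conj_emb_real eqxx.
- by left; left.
- by right; left.
- by right; right => y; rewrite e (@conj_emb_conj 2).
- by left; right => y; rewrite e (@conj_emb_conj 1).
Qed.

Lemma conj_class_log k rho u : conj_class k rho -> log_complex rho u = ell k u.
Proof. by case=> [/log_complex_eq|/log_complex_conj]. Qed.

Lemma conj_class_inj k tau rho : conj_class k tau -> conj_class k rho ->
  tau =1 rho \/ conj_embeddings tau rho.
Proof.
case=> [et|et] [er|er].
- by left=> x; rewrite et er.
- by right=> x; rewrite et er.
- by right=> x; rewrite et er conjcK.
- by left=> x; rewrite et er.
Qed.

Lemma represent_conj_emb : represent_complex_pairs (conj_emb 1) (conj_emb 2).
Proof.
split.
- exact: conj_emb_nonreal.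
- exact: conj_emb_nonreal.
- exact: (@conj_emb_neq 1 1).
- move=> h; apply: (@conj_emb_neq 2 2) => // x.
  by rewrite h (@conj_emb_conj 1).
move=> rho /nonreal_conj_class[] [] h.
- by constructor 1.
- by constructor 2.
- by constructor 3.
- by constructor 4.
Qed.

(** The two embeddings lie in different conjugate pairs, but their order is not
determined. *)
Lemma represent_complex_pairs_log tau1 tau2 : represent_complex_pairs tau1 tau2 ->
  (log_complex tau1 =1 ell 1 /\ log_complex tau2 =1 ell 2) \/
  (log_complex tau1 =1 ell 2 /\ log_complex tau2 =1 ell 1).
Proof.
case=> n1 n2 ne nc _.
have [h1|h1] := nonreal_conj_class n1; have [h2|h2] := nonreal_conj_class n2.
- by case: (conj_class_inj h1 h2).
- by left; split=> u; apply: conj_class_log.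
- by right; split=> u; apply: conj_class_log.
- by case: (conj_class_inj h1 h2).
Qed.

(** The rows (l_0, 2 l_1, 2 l_2) sum to 0 by ell_norm, so the three minors agree
up to sign; this is the one on the first two columns. *)
Definition minor2 (u v : E) : R := ell 0 u * (2 * ell 1 v) - (2 * ell 1 u) * ell 0 v.

Lemma abs_minorE tau1 tau2 (b : 2.-tuple E) k : represent_complex_pairs tau1 tau2 ->
  abs_minor iota tau1 tau2 b k = `|minor2 (tnth b 0) (tnth b 1)|.
Proof.
move=> rep; have h0 := ell_norm (tnth b 0); have h1 := ell_norm (tnth b 1).
rewrite /abs_minor det_mx2 !mxE !(tnth_nth 0) /= in h0 h1 *.
rewrite (_ : 1 %% 2 = 1)%N // in h1 *.
move: (b`_0) (b`_1) h0 h1 => u v h0 h1.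
rewrite !log_real_ell /minor2.
have e0 : 2 * ell 2 u = - ell 0 u - 2 * ell 1 u by lra.
have e1 : 2 * ell 2 v = - ell 0 v - 2 * ell 1 v by lra.
case: (represent_complex_pairs_log rep) => -[t1 t2]; rewrite !t1 !t2 !e0 !e1;
  case: k => [[|[|[|//]]]] hk; rewrite /bump /=;
  first [by congr `|_|; ring | by rewrite -normrN; congr `|_|; ring].
Qed.

Lemma minor2_act p q r s' u v :
  minor2 (u *~ p + v *~ q) (u *~ r + v *~ s') = (p * s' - q * r)%:~R * minor2 u v.
Proof.
have lin k x y (m n : int) : ell k (x *~ m + y *~ n) = m%:~R * ell k x + n%:~R * ell k y.
  by rewrite raddfD !raddfMz !mulrzl.
rewrite /minor2 !lin rmorphB !rmorphM /=; ring.
Qed.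

(** Each of the two minors is an integer multiple of the other, as minor2 is
alternating and each basis is an integer combination of the other. *)
Lemma minor2_Zbasis (b b' : 2.-tuple E) : is_Zbasis b -> is_Zbasis b' ->
  `|minor2 (tnth b 0) (tnth b 1)| = `|minor2 (tnth b' 0) (tnth b' 1)|.
Proof.
have multiple (x y : 2.-tuple E) : is_Zbasis x ->
    exists d : int,
      minor2 (tnth y 0) (tnth y 1) = d%:~R * minor2 (tnth x 0) (tnth x 1).
  move=> hx; have [p [q e0]] := Zbasis2_coord hx (tnth y 0).
  have [r [s' e1]] := Zbasis2_coord hx (tnth y 1).
  by exists (p * s' - q * r); rewrite [in LHS]e0 [in LHS]e1 minor2_act.
move=> hb hb'; have [d h] := multiple b' b hb'; have [d' h'] := multiple b b' hb.
exact: eq_norm_int_multiples h h'.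
Qed.

Lemma regulator_gal_trace u0 : is_Zbasis [tuple u0; gal_trace u0] ->
  is_regulator iota `|N5 (log_real iota u0) (log_real iota (gal_trace u0))|.
Proof.
move=> hb; split.
  exists [tuple u0; gal_trace u0], (conj_emb 1), (conj_emb 2); split=> //.
  exact: represent_conj_emb.
move=> b tau1 tau2 k bb rep; rewrite abs_minorE // (minor2_Zbasis bb hb).
rewrite !(tnth_nth 0) /= /minor2 /N5 !log_real_ell ell0_gal_trace ell1_gal_trace.
have e0 : 2 * ell 2 u0 = - ell 0 u0 - 2 * ell 1 u0 by have := ell_norm u0; lra.
by rewrite !mulrDr e0; congr `|_|; ring.
Qed.

End Conjugates.

Theorem theorem1p2 (R : realType) (L : splittingFieldType rat)
    (K : {subfield L}) (hK : D5_extension K)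
    (iota : {rmorphism subvs_of K -> R}) (hiota : unique_real_embedding iota)
    (sigma : gal_of {:L}) (hsigma : sigma \in 'Gal({:L} / 1)%g)
    (ord_sigma : #[sigma]%g = 5%N) :
  (exists u0 u1 : Egroup (subvs_of K),
     is_gal_trace sigma u0 u1 /\ is_Zbasis [tuple u0; u1]) /\
  (forall u0 u1 : Egroup (subvs_of K),
     is_gal_trace sigma u0 u1 -> is_Zbasis [tuple u0; u1] ->
     is_regulator iota `|N5 (log_real iota u0) (log_real iota u1)|).
Proof.
have [J [c D]] := conj_embedding_exists hK hiota hsigma ord_sigma.
split.
  have [u0 h] := Zbasis_of_units D (let: And3 d _ _ := hK in d).
  by exists u0, (gal_trace D u0); split=> //; exact: gal_traceP.
by move=> u0 u1 /(gal_trace_unique D) ->; exact: regulator_gal_trace.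
Qed.
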